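(* Let $\vec b = (b_1, \ldots, b_n)$ be an $n$-tuple of integers. There exists an isomorphism of supermanifolds $$\mathbb{P}_{\mathbb{C}}^{m|n}(1|\vec b)\;\cong\; S\Big(\mathbb{P}_{\mathbb{C}}^m,\ \bigoplus_{j=1}^n \mathcal{O}_{\mathbb{P}_{\mathbb{C}}^m}(-b_j)\Big).$$
   Context: An analytic superspace is a locally ringed space $\mathfrak{X}=(X,\mathcal{O}_{\mathfrak X})$, where $X$ underlies a complex analytic space $(X,\mathcal{O}_X)$ and $\mathcal{O}_{\mathfrak X}$ is a sheaf of supercommutative rings on $X$ locally isomorphic to the exterior algebra $\wedge^\bullet_{\mathcal{O}_X} T^*_{X,-}$ of some locally free sheaf of $\mathcal{O}_X$-modules $T^*_{X,-}$ (the odd cotangent sheaf). The split superspace $S(X,T^*_{X,-})$ is the locally ringed space $(X,\wedge^\bullet_{\mathcal{O}_X}T^*_{X,-})$. The fermionic ideal $\mathcal{J}$ is the kernel of $\mathcal{O}_{\mathfrak X}\twoheadrightarrow\mathcal{O}_X$; $(X,\mathcal{O}_X)$ is the reduced space and $T^*_{X,-}=\mathcal{J}/\mathcal{J}^2$. A (complex) supermanifold is an analytic superspace whose reduced space is a complex manifold. On $\mathbb{C}^{m+1|n}$ with global even coordinates $x^1,\dots,x^{m+1}$ and odd coordinates $\theta_1,\dots,\theta_n$, let $\lambda\in\mathbb{C}^\times$ act by $(x^\mu|\theta_a)\mapsto(\lambda x^\mu|\lambda^{b_a}\theta_a)$. The projective superspace $\mathbb{P}^{m|n}_{\mathbb{C}}(1|\vec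 b)$ is the quotient of $\mathbb{C}^{m+1|n}-\{(0|0)\}$ by this action: its structure sheaf is the sheaf of $\mathbb{C}^\times$-invariant functions; on the open set $x^\mu\neq0$ it has even coordinates $x^\nu/x^\mu$ and odd coordinates $\theta_a/(x^\mu)^{b_a}$. *)

(* Defs.v *)
(* Everything is generic in an algebraically closed normed field C, to be
   taken to be the field R[i] of complex numbers. *)
From HB Require Import structures.
From mathcomp Require Import all_boot all_order all_algebra.
From mathcomp Require Import complex.

Set Implicit Arguments.
Unset Strict Implicit.
Unset Printing Implicit Defensive.

Import Order.TTheory GRing.Theory Num.Theory.
Local Open Scope ring_scope.

(* The algebra A[theta_1, .., theta_n] of the odd coordinates: [f] stands for
   \sum_I f I theta_I, where theta_I is the increasing product over I, so that
   theta_I theta_J = (-1)^(inversions I J) theta_(I :|: J) for disjoint I, J. *)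
Section Grassmann.
Variables (n : nat) (A : comPzRingType).
Local Notation idx := {set 'I_n}.

Definition inversions (I J : idx) : nat :=
  (\sum_(i in I) \sum_(j in J) (j < i))%N.

Definition grassmann : Type := {ffun idx -> A}.
HB.instance Definition _ := GRing.Zmodule.on grassmann.

Definition gmul (f g : grassmann) : grassmann :=
  [ffun K : idx => \sum_(I : idx | I \subset K)
    (-1) ^+ inversions I (K :\: I) * (f I * g (K :\: I))].
Definition gone : grassmann := [ffun K : idx => (K == set0)%:R].

Lemma inversionsl (I L K : idx) : I \subset L ->
  inversions L K = (inversions I K + inversions (L :\: I) K)%N.
Proof. by move=> /setIidPr IL; rewrite /inversions (big_setID I) /= IL. Qed.

Lemma inversionsr (I J K : idx) : J \subset K ->
  inversions I K = (inversions I J + inversions I (K :\: J))%N.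
Proof.
move=> /setIidPr JK; rewrite /inversions -big_split /=; apply: eq_bigr => i _.
by rewrite (big_setID J) /= JK.
Qed.

Lemma gmulA : associative gmul.
Proof.
move=> f g h; apply/ffunP => K; rewrite !ffunE.
transitivity (\sum_(I : idx | I \subset K) \sum_(L : idx | (I \subset L) && (L \subset K))
  (-1) ^+ (inversions L (K :\: L) + inversions I (L :\: I)) *
    (f I * g (L :\: I) * h (K :\: L))); last first.
  rewrite (exchange_big_dep (fun L : idx => L \subset K)) /=; last first.
    by move=> I L _ /andP[].
  apply: eq_bigr => L LK; rewrite ffunE big_distrl big_distrr /=.
  apply: eq_big => [I|I /andP[_ /andP[IL _]]].
    by rewrite LK andbT; apply: andb_idl => /subset_trans; exact.
  by rewrite exprD !mulrA.
apply: eq_bigr => I IK; rewrite ffunE !big_distrr /=.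
rewrite (reindex_onto (fun L : idx => L :\: I) (fun J : idx => I :|: J)) /=; last first.
  move=> J JK; rewrite setDUl setDv set0U; apply/setDidPl.
  by move: JK; rewrite subsetD => /andP[].
have E (L : idx) : (L :\: I \subset K :\: I) && (I :|: L :\: I == L) =
    (I \subset L) && (L \subset K).
  apply/andP/andP=> [[LK /eqP e]|[IL LK]].
    have IL : I \subset L by rewrite -e subsetUl.
    split=> //; rewrite -e subUset IK /=.
    exact: subset_trans LK (subsetDl _ _).
  by rewrite setSD // -{1}(setIidPr IL) setID.
rewrite (eq_bigl _ _ E); apply: eq_bigr => L /andP[IL LK].
have -> : K :\: I :\: (L :\: I) = K :\: L.
  apply/setP => x; rewrite !inE; case: (boolP (x \in I)) => xI //=.
  by rewrite (subsetP IL _ xI).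
have IJ : L :\: I \subset K :\: I by exact: setSD.
rewrite (inversionsr I IJ) (inversionsl _ IL).
have -> : K :\: I :\: (L :\: I) = K :\: L.
  apply/setP => x; rewrite !inE; case: (boolP (x \in I)) => xI //=.
  by rewrite (subsetP IL _ xI).
rewrite [f I * _]mulrCA [LHS]mulrA -exprD [f I * (_ * _)]mulrA; congr (_ ^+ _ * _).
by rewrite -addnA [RHS]addnC.
Qed.

Lemma inversions0l J : inversions set0 J = 0%N.
Proof. by rewrite /inversions big_set0. Qed.
Lemma inversions0r J : inversions J set0 = 0%N.
Proof. by rewrite /inversions big1 // => i _; rewrite big_set0. Qed.

Lemma gmul1 : left_id gone gmul.
Proof.
move=> f; apply/ffunP => K; rewrite ffunE (bigD1 set0) ?sub0set //=.
rewrite big1 ?addr0 => [|I /andP[_ /negbTE I0]].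
  by rewrite ffunE eqxx inversions0l setD0 !mul1r.
by rewrite ffunE I0 mul0r mulr0.
Qed.
Lemma gmulr1 : right_id gone gmul.
Proof.
move=> f; apply/ffunP => K; rewrite ffunE (bigD1 K) //=.
rewrite big1 ?addr0 => [|I /andP[IK nIK]].
  by rewrite ffunE setDv eqxx inversions0r mulr1 mul1r.
have /negbTE KI : ~~ (K \subset I) by apply: contra nIK => KI; rewrite eqEsubset IK.
by rewrite ffunE setD_eq0 KI !mulr0.
Qed.
Lemma gmulDl : left_distributive gmul +%R.
Proof.
move=> f g h; apply/ffunP => K; rewrite !ffunE -big_split /=.
by apply: eq_bigr => I _; rewrite ffunE mulrDl mulrDr.
Qed.
Lemma gmulDr : right_distributive gmul +%R.
Proof.
move=> f g h; apply/ffunP => K; rewrite !ffunE -big_split /=.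
by apply: eq_bigr => I _; rewrite ffunE !mulrDr.
Qed.
HB.instance Definition _ :=
  GRing.Zmodule_isPzRing.Build grassmann gmulA gmul1 gmulr1 gmulDl gmulDr.

Definition gscal (a : A) : grassmann :=
  [ffun K : idx => if K == set0 then a else 0].

Lemma gscal_zmod : zmod_morphism gscal.
Proof.
by move=> a b; apply/ffunP => K; rewrite !ffunE; case: eqP => // _; rewrite subr0.
Qed.
Lemma gscal_monoid : monoid_morphism gscal.
Proof.
split=> [|a b]; apply/ffunP => K; rewrite !ffunE; first by case: eqP.
rewrite (bigD1 set0) ?sub0set //= big1 => [|I /andP[_ /negbTE I0]].
  rewrite !ffunE eqxx inversions0l setD0 mul1r addr0.
  by case: eqP => // _; rewrite mulr0.
by rewrite ffunE I0 mul0r mulr0.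
Qed.
HB.instance Definition _ := GRing.isZmodMorphism.Build A grassmann gscal gscal_zmod.
HB.instance Definition _ :=
  GRing.isMonoidMorphism.Build A grassmann gscal gscal_monoid.

Definition ghomog (p : bool) (f : grassmann) : Prop :=
  forall I : idx, odd #|I| != p -> f I = 0.
End Grassmann.

Section GrassmannMap.
Variables (n : nat) (A B : comPzRingType) (sg : {rmorphism A -> B}).

Definition gmap (f : grassmann n A) : grassmann n B :=
  [ffun I : {set 'I_n} => sg (f I)].

Lemma gmap_zmod : zmod_morphism gmap.
Proof. by move=> f g; apply/ffunP => K; rewrite !ffunE rmorphB. Qed.
Lemma gmap_monoid : monoid_morphism gmap.
Proof.
split=> [|f g]; apply/ffunP => K; rewrite !ffunE ?rmorph_nat // rmorph_sum.
by apply: eq_bigr => I _; rewrite !rmorphM rmorph_sign !ffunE.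
Qed.
HB.instance Definition _ := GRing.isZmodMorphism.Build
  (grassmann n A) (grassmann n B) gmap gmap_zmod.
HB.instance Definition _ := GRing.isMonoidMorphism.Build
  (grassmann n A) (grassmann n B) gmap gmap_monoid.
End GrassmannMap.

From mathcomp Require Import all_classical all_reals all_analysis.
Import numFieldNormedType.Exports.
Local Open Scope classical_set_scope.
Local Open Scope quotient_scope.

Record opens (X : topologicalType) := Opens {
  oset :> set X;
  osetP : open oset }.

Definition opreim (X Y : topologicalType) (f : X -> Y) (fc : continuous f)
    (V : opens Y) : opens X :=
  Opens (open_comp (fun x _ => fc x) (osetP V)).

Definition opensI (X : topologicalType) (U V : opens X) : opens X :=
  Opens (openI (osetP U) (osetP V)).

Definition opensT (X : topologicalType) : opens X := Opens (@openT X).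

Definition incl (X : Type) (U V : set X) (h : V `<=` U) (x : V) : U :=
  exist _ (val x) (mem_set (h _ (set_mem (valP x)))).

Definition is_sheaf (X : topologicalType) (F : opens X -> Type)
    (res : forall U V : opens X, V `<=` U -> F U -> F V) :=
  forall (U : opens X) (I : Type) (W : I -> opens X)
    (WU : forall i, W i `<=` U), U `<=` \bigcup_i W i ->
  forall s : (forall i, F (W i)),
    (forall i j (V : opens X) (hi : V `<=` W i) (hj : V `<=` W j),
      res _ _ hi (s i) = res _ _ hj (s j)) ->
  exists! t : F U, forall i, res _ _ (WU i) t = s i.

Section Sheaves.
Variable C : numClosedFieldType.

(* A sheaf of C-algebras of C-valued functions on X, given by its stalks:
   [hol x f] says that the germ at x of f is a section.  The reduced spaces of
   supermanifolds are complex manifolds, so their structure sheaves are of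
   this kind. *)
Record function_sheaf (X : topologicalType) := FunctionSheaf {
  hol : X -> set (X -> C);
  hol_near : forall x f g, (\forall y \near x, f y = g y) ->
    hol x f -> hol x g;
  hol_open : forall x f, hol x f -> \forall y \near x, hol y f;
  hol_cst : forall x c, hol x (cst c);
  holB : forall x f g, hol x f -> hol x g -> hol x (f \- g);
  holM : forall x f g, hol x f -> hol x g -> hol x (f \* g) }.

Section Sections.
Variables (X : topologicalType) (A : function_sheaf X) (U : opens X).

Definition regular : {pred U -> C} := fun f =>
  `[< exists2 F : X -> C, forall x, oset U x -> hol A x F
      & forall x : U, f x = F (val x) >].

Lemma regular_subring : subring_closed regular.
Proof.
split.
- by apply/asboolP; exists (cst 1) => // x _; exact: hol_cst.
- move=> f g /asboolP[F hF fF] /asboolP[G hG gG]; apply/asboolP.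
  exists (F \- G) => [x Ux|x]; first by apply: holB; [exact: hF|exact: hG].
  by rewrite -[LHS]/(f x - g x) fF gG.
- move=> f g /asboolP[F hF fF] /asboolP[G hG gG]; apply/asboolP.
  exists (F \* G) => [x Ux|x]; first by apply: holM; [exact: hF|exact: hG].
  by rewrite -[LHS]/(f x * g x) fF gG.
Qed.

Record regfun := Regfun { rfun :> U -> C; rfunP : rfun \in regular }.

HB.instance Definition _ := [isSub for rfun].
HB.instance Definition _ := [Choice of regfun by <:].
HB.instance Definition _ :=
  GRing.SubChoice_isSubComPzRing.Build (U -> C) regular regfun regular_subring.

Lemma rfunE (f : regfun) :
  exists2 F : X -> C, forall x, oset U x -> hol A x F & forall x, f x = F (val x).
Proof. by have /asboolP := rfunP f. Qed.

Lemma regfunP (f g : regfun) : f =1 g -> f = g.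
Proof. by move=> fg; apply/val_inj/funext. Qed.

Lemma rfun0 x : (0 : regfun) x = 0. Proof. by []. Qed.
Lemma rfun1 x : (1 : regfun) x = 1. Proof. by []. Qed.
Lemma rfunB (f g : regfun) x : (f - g) x = f x - g x. Proof. by []. Qed.
Lemma rfunM (f g : regfun) x : (f * g) x = f x * g x. Proof. by []. Qed.
Lemma rfunD (f g : regfun) x : (f + g) x = f x + g x. Proof. by []. Qed.

Lemma rcst_subproof c : (fun _ : U => c) \in regular.
Proof. by apply/asboolP; exists (cst c) => // x _; exact: hol_cst. Qed.

Definition rcst (c : C) : regfun := Regfun (rcst_subproof c).

Lemma rcst_zmod : zmod_morphism rcst. Proof. by move=> a b; exact: regfunP. Qed.
Lemma rcst_monoid : monoid_morphism rcst.
Proof. by split=> [|a b]; exact: regfunP. Qed.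
HB.instance Definition _ := GRing.isZmodMorphism.Build C regfun rcst rcst_zmod.
HB.instance Definition _ :=
  GRing.isMonoidMorphism.Build C regfun rcst rcst_monoid.
End Sections.
Arguments regular {X} A U.

Section Restriction.
Variables (X : topologicalType) (A : function_sheaf X).

Lemma rres_subproof (U V : opens X) (h : V `<=` U) (f : regfun A U) :
  (f \o incl h) \in regular A V.
Proof.
have [F hF fF] := rfunE f; apply/asboolP; exists F => [x /h|x]; first exact: hF.
by rewrite /= fF.
Qed.

Definition rres (U V : opens X) (h : V `<=` U) (f : regfun A U) : regfun A V :=
  Regfun (rres_subproof h f).

Lemma rres_zmod (U V : opens X) (h : V `<=` U) : zmod_morphism (@rres U V h).
Proof. by move=> a b; exact: regfunP. Qed.
Lemma rres_monoid (U V : opens X) (h : V `<=` U) : monoid_morphism (@rres U V h).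
Proof. by split=> [|a b]; exact: regfunP. Qed.
HB.instance Definition _ (U V : opens X) (h : V `<=` U) :=
  GRing.isZmodMorphism.Build (regfun A U) (regfun A V) (rres h) (rres_zmod h).
HB.instance Definition _ (U V : opens X) (h : V `<=` U) :=
  GRing.isMonoidMorphism.Build (regfun A U) (regfun A V) (rres h)
    (rres_monoid h).

Lemma incl_id (U : opens X) (h : U `<=` U) (x : U) : incl h x = x.
Proof. exact: val_inj. Qed.

Lemma incl_comp (U V W : opens X) (h : V `<=` U) (k : W `<=` V) (l : W `<=` U)
  (x : W) : incl h (incl k x) = incl l x.
Proof. exact: val_inj. Qed.

Lemma rres_id (U : opens X) (h : U `<=` U) f : rres h f = f.
Proof. by apply: regfunP => x /=; rewrite incl_id. Qed.

Lemma rres_comp (U V W : opens X) (h : V `<=` U) (k : W `<=` V) (l : W `<=` U)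
  f : rres k (rres h f) = rres l f.
Proof. by apply: regfunP => x /=; rewrite (incl_comp h k l). Qed.

Lemma rres_cst (U V : opens X) (h : V `<=` U) c :
  rres h (rcst A U c) = rcst A V c.
Proof. exact: regfunP. Qed.
End Restriction.

Record omodule (X : topologicalType) (A : function_sheaf X) := OModule {
  msec :> forall U : opens X, lmodType (regfun A U);
  mres : forall U V : opens X, V `<=` U -> msec U -> msec V;
  mres_lin : forall (U V : opens X) (h : V `<=` U) a s t,
    mres h (a *: s + t) = rres h a *: mres h s + mres h t;
  mres_id : forall (U : opens X) (h : U `<=` U) s, mres h s = s;
  mres_comp : forall (U V W : opens X) (h : V `<=` U) (k : W `<=` V)
    (l : W `<=` U) s, mres k (mres h s) = mres l s }.

Definition locally_free (X : topologicalType) (A : function_sheaf X)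
    (E : omodule A) :=
  is_sheaf (mres (o := E)) /\
  forall x : X, exists (U : opens X) (r : nat) (e : 'I_r -> E U), oset U x /\
    forall (V : opens X) (h : V `<=` U) (s : E V),
      exists! a : 'I_r -> regfun A V, s = \sum_i a i *: mres h (e i).

Section DirectSum.
Variables (I : Type) (A : pzRingType) (M : I -> lmodType A).

Definition dsum : Type := forall i, M i.

HB.instance Definition _ := gen_eqMixin dsum.
HB.instance Definition _ := gen_choiceMixin dsum.

Let dadd (s t : dsum) : dsum := fun i => s i + t i.
Let dopp (s : dsum) : dsum := fun i => - s i.
Let dscale (a : A) (s : dsum) : dsum := fun i => a *: s i.

Lemma daddA : associative dadd.
Proof. by move=> a b c; apply: functional_extensionality_dep => i; exact: addrA. Qed.
Lemma daddC : commutative dadd.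
Proof. by move=> a b; apply: functional_extensionality_dep => i; exact: addrC. Qed.
Lemma dadd0 : left_id (fun i => 0 : M i) dadd.
Proof. by move=> a; apply: functional_extensionality_dep => i; exact: add0r. Qed.
Lemma daddN : left_inverse (fun i => 0 : M i) dopp dadd.
Proof. by move=> a; apply: functional_extensionality_dep => i; exact: addNr. Qed.
HB.instance Definition _ := GRing.isZmodule.Build dsum daddA daddC dadd0 daddN.

Lemma dscaleA a b v : dscale a (dscale b v) = dscale (a * b) v.
Proof. by apply: functional_extensionality_dep => i; exact: scalerA. Qed.
Lemma dscale1 : left_id 1 dscale.
Proof. by move=> a; apply: functional_extensionality_dep => i; exact: scale1r. Qed.
Lemma dscaleDr : right_distributive dscale +%R.
Proof. by move=> a b c; apply: functional_extensionality_dep => i; exact: scalerDr. Qed.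
Lemma dscaleDl v : {morph dscale^~ v : a b / a + b}.
Proof. by move=> a b; apply: functional_extensionality_dep => i; exact: scalerDl. Qed.
HB.instance Definition _ :=
  GRing.Zmodule_isLmodule.Build A dsum dscaleA dscale1 dscaleDr dscaleDl.
End DirectSum.

(* The presheaf direct sum; it is already a sheaf for sheaves, the index set
   being finite. *)
Section DirectSumModule.
Variables (X : topologicalType) (A : function_sheaf X).
Variables (I : finType) (E : I -> omodule A).

Definition dsum_res (U V : opens X) (h : V `<=` U)
    (s : dsum (fun i => E i U)) : dsum (fun i => E i V) :=
  fun i => mres h (s i).

Lemma dsum_res_lin (U V : opens X) (h : V `<=` U) a s t :
  dsum_res h (a *: s + t) = rres h a *: dsum_res h s + dsum_res h t.
Proof. by apply: functional_extensionality_dep => i; exact: mres_lin. Qed.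
Lemma dsum_res_id (U : opens X) (h : U `<=` U) s : dsum_res h s = s.
Proof. by apply: functional_extensionality_dep => i; exact: mres_id. Qed.
Lemma dsum_res_comp (U V W : opens X) (h : V `<=` U) (k : W `<=` V)
  (l : W `<=` U) s : dsum_res k (dsum_res h s) = dsum_res l s.
Proof. by apply: functional_extensionality_dep => i; exact: mres_comp. Qed.

Definition omodule_dsum : omodule A :=
  OModule dsum_res_lin dsum_res_id dsum_res_comp.
End DirectSumModule.

End Sheaves.
Arguments regular {C X} A U.

(* The exterior algebra of a module M over a commutative ring A, presented by
   generators and relations: [ext_eq] is the congruence generated by the axioms
   of an associative A-algebra, A-linearity of M -> /\M, and m * m = 0. *)
Section Exterior.
Variables (A : comPzRingType) (M : lmodType A).

Inductive ext_term :=
  | EScal of A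
  | EGen of M
  | EAdd of ext_term & ext_term
  | EMul of ext_term & ext_term.

Inductive ext_eq : ext_term -> ext_term -> Prop :=
  | ext_refl s : ext_eq s s
  | ext_sym s t : ext_eq s t -> ext_eq t s
  | ext_trans s t u : ext_eq s t -> ext_eq t u -> ext_eq s u
  | ext_add s s' t t' : ext_eq s s' -> ext_eq t t' ->
      ext_eq (EAdd s t) (EAdd s' t')
  | ext_mul s s' t t' : ext_eq s s' -> ext_eq t t' ->
      ext_eq (EMul s t) (EMul s' t')
  | ext_addA s t u : ext_eq (EAdd s (EAdd t u)) (EAdd (EAdd s t) u)
  | ext_addC s t : ext_eq (EAdd s t) (EAdd t s)
  | ext_add0 s : ext_eq (EAdd (EScal 0) s) s
  | ext_addN s : ext_eq (EAdd (EMul (EScal (-1)) s) s) (EScal 0)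
  | ext_mulA s t u : ext_eq (EMul s (EMul t u)) (EMul (EMul s t) u)
  | ext_mul1 s : ext_eq (EMul (EScal 1) s) s
  | ext_mulDl s t u : ext_eq (EMul (EAdd s t) u) (EAdd (EMul s u) (EMul t u))
  | ext_mulDr s t u : ext_eq (EMul s (EAdd t u)) (EAdd (EMul s t) (EMul s u))
  | ext_scalD a b : ext_eq (EScal (a + b)) (EAdd (EScal a) (EScal b))
  | ext_scalM a b : ext_eq (EScal (a * b)) (EMul (EScal a) (EScal b))
  | ext_scalC a s : ext_eq (EMul (EScal a) s) (EMul s (EScal a))
  | ext_genD x y : ext_eq (EGen (x + y)) (EAdd (EGen x) (EGen y))
  | ext_genZ a x : ext_eq (EGen (a *: x)) (EMul (EScal a) (EGen x))
  | ext_alt x : ext_eq (EMul (EGen x) (EGen x)) (EScal 0).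

(* Homogeneous terms: sums of products of generators with a fixed parity of
   the number of factors. *)
Inductive ext_par : bool -> ext_term -> Prop :=
  | ext_par_scal a : ext_par false (EScal a)
  | ext_par0 p : ext_par p (EScal 0)
  | ext_par_gen x : ext_par true (EGen x)
  | ext_par_add p s t : ext_par p s -> ext_par p t -> ext_par p (EAdd s t)
  | ext_par_mul p q s t : ext_par p s -> ext_par q t ->
      ext_par (p (+) q) (EMul s t).

Definition ext_eqb (s t : {classic ext_term}) : bool := `[< ext_eq s t >].
Lemma ext_eqb_refl : reflexive ext_eqb.
Proof. by move=> s; apply/asboolP; exact: ext_refl. Qed.
Lemma ext_eqb_sym : symmetric ext_eqb.
Proof. by move=> s t; apply/asboolP/asboolP; exact: ext_sym. Qed.
Lemma ext_eqb_trans : transitive ext_eqb.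
Proof. by move=> s t u /asboolP ts /asboolP su; apply/asboolP; exact: ext_trans su. Qed.
Canonical ext_equiv := EquivRel ext_eqb ext_eqb_refl ext_eqb_sym ext_eqb_trans.

Definition exterior : Type := {eq_quot ext_eqb}.
HB.instance Definition _ := Choice.on exterior.

Definition ext_pi (s : ext_term) : exterior := \pi_{eq_quot ext_eqb} s.

Lemma ext_piP s t : ext_pi s = ext_pi t <-> ext_eq s t.
Proof.
by split=> [/eqP|st]; [|apply/eqP]; rewrite /ext_pi piE; [move=> /asboolP|apply/asboolP].
Qed.

Lemma ext_ind (P : exterior -> Prop) :
  (forall s, P (ext_pi s)) -> forall x, P x.
Proof. by move=> H; elim/quotW. Qed.

Let rep (x : exterior) : ext_term := repr (x : {eq_quot ext_eqb}).
Let repK x : ext_pi (rep x) = x. Proof. exact: reprK. Qed.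
Let rep_pi s : ext_eq (rep (ext_pi s)) s. Proof. by apply/ext_piP; rewrite repK. Qed.

Definition ext_zero := ext_pi (EScal 0).
Definition ext_one := ext_pi (EScal 1).
Definition ext_addq x y := ext_pi (EAdd (rep x) (rep y)).
Definition ext_mulq x y := ext_pi (EMul (rep x) (rep y)).
Definition ext_oppq x := ext_pi (EMul (EScal (-1)) (rep x)).

Let addE s t : ext_addq (ext_pi s) (ext_pi t) = ext_pi (EAdd s t).
Proof. by apply/ext_piP/ext_add; exact: rep_pi. Qed.
Let mulE s t : ext_mulq (ext_pi s) (ext_pi t) = ext_pi (EMul s t).
Proof. by apply/ext_piP/ext_mul; exact: rep_pi. Qed.
Let oppE s : ext_oppq (ext_pi s) = ext_pi (EMul (EScal (-1)) s).
Proof. by apply/ext_piP/ext_mul; [exact: ext_refl|exact: rep_pi]. Qed.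

Lemma ext_addqA : associative ext_addq.
Proof.
elim/ext_ind=> s; elim/ext_ind=> t; elim/ext_ind=> u.
by rewrite !addE; apply/ext_piP/ext_addA.
Qed.
Lemma ext_addqC : commutative ext_addq.
Proof.
by elim/ext_ind=> s; elim/ext_ind=> t; rewrite !addE; apply/ext_piP/ext_addC.
Qed.
Lemma ext_addq0 : left_id ext_zero ext_addq.
Proof. by elim/ext_ind=> s; rewrite !addE; apply/ext_piP/ext_add0. Qed.
Lemma ext_addqN : left_inverse ext_zero ext_oppq ext_addq.
Proof. by elim/ext_ind=> s; rewrite oppE addE; apply/ext_piP/ext_addN. Qed.
Lemma ext_mulqA : associative ext_mulq.
Proof.
elim/ext_ind=> s; elim/ext_ind=> t; elim/ext_ind=> u.
by rewrite !mulE; apply/ext_piP/ext_mulA.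
Qed.
Lemma ext_mulq1 : left_id ext_one ext_mulq.
Proof. by elim/ext_ind=> s; rewrite !mulE; apply/ext_piP/ext_mul1. Qed.
Lemma ext_mul1q : right_id ext_one ext_mulq.
Proof.
elim/ext_ind=> s; rewrite !mulE; apply/ext_piP.
exact: ext_trans (ext_sym (ext_scalC _ _)) (ext_mul1 _).
Qed.
Lemma ext_mulqDl : left_distributive ext_mulq ext_addq.
Proof.
elim/ext_ind=> s; elim/ext_ind=> t; elim/ext_ind=> u.
by rewrite !(addE, mulE); apply/ext_piP/ext_mulDl.
Qed.
Lemma ext_mulqDr : right_distributive ext_mulq ext_addq.
Proof.
elim/ext_ind=> s; elim/ext_ind=> t; elim/ext_ind=> u.
by rewrite !(addE, mulE); apply/ext_piP/ext_mulDr.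
Qed.

HB.instance Definition _ := GRing.isPzRing.Build exterior ext_addqA ext_addqC
  ext_addq0 ext_addqN ext_mulqA ext_mulq1 ext_mul1q ext_mulqDl ext_mulqDr.

Lemma ext_piD s t : ext_pi (EAdd s t) = ext_pi s + ext_pi t.
Proof. by rewrite -addE. Qed.
Lemma ext_piM s t : ext_pi (EMul s t) = ext_pi s * ext_pi t.
Proof. by rewrite -mulE. Qed.

Definition ext_scal (a : A) : exterior := ext_pi (EScal a).
Definition ext_gen (x : M) : exterior := ext_pi (EGen x).

Lemma ext_scal_zmod : zmod_morphism ext_scal.
Proof.
move=> a b; apply/(addIr (ext_scal b)); rewrite subrK -ext_piD.
by apply/ext_piP/ext_sym; rewrite -{1}[a](subrK b); exact: ext_scalD.
Qed.
Lemma ext_scal_monoid : monoid_morphism ext_scal.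
Proof. by split=> // a b; rewrite -ext_piM; apply/ext_piP/ext_scalM. Qed.
HB.instance Definition _ :=
  GRing.isZmodMorphism.Build A exterior ext_scal ext_scal_zmod.
HB.instance Definition _ :=
  GRing.isMonoidMorphism.Build A exterior ext_scal ext_scal_monoid.

Definition ext_homog (p : bool) : set exterior :=
  [set x | exists2 s, ext_par p s & x = ext_pi s].
End Exterior.
Arguments EScal {A M}.
Arguments ext_scal {A} M.

(* Functoriality along a ring morphism and a semilinear map. *)
Section ExteriorMap.
Variables (A B : comPzRingType) (M : lmodType A) (N : lmodType B).
Variables (sg : {rmorphism A -> B}) (f : M -> N).
Hypothesis f_lin : forall a x y, f (a *: x + y) = sg a *: f x + f y.

Fixpoint ext_tmap (s : ext_term M) : ext_term N :=
  match s with
  | EScal a => EScal (sg a)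
  | EGen x => EGen (f x)
  | EAdd s t => EAdd (ext_tmap s) (ext_tmap t)
  | EMul s t => EMul (ext_tmap s) (ext_tmap t)
  end.

Lemma ext_tmap_eq s t : ext_eq s t -> ext_eq (ext_tmap s) (ext_tmap t).
Proof.
have f0 : f 0 = 0.
  have := f_lin 1 0 0; rewrite scaler0 addr0 rmorph1 scale1r => /eqP.
  by rewrite addrC -subr_eq subrr eq_sym => /eqP.
have fD x y : f (x + y) = f x + f y.
  by have := f_lin 1 x y; rewrite rmorph1 !scale1r.
have fZ a x : f (a *: x) = sg a *: f x.
  by have := f_lin a x 0; rewrite f0 !addr0.
elim=> {s t} /=; rewrite ?(rmorph0, rmorph1, rmorphN1); try by constructor.
- by move=> s t u _ IH1 _ IH2; exact: ext_trans IH2.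
- by move=> a b; rewrite rmorphD; constructor.
- by move=> a b; rewrite rmorphM; constructor.
- by move=> x y; rewrite fD; constructor.
- by move=> a x; rewrite fZ; constructor.
Qed.

Definition ext_map (x : exterior M) : exterior N :=
  ext_pi (ext_tmap (repr (x : {eq_quot @ext_eqb A M}))).

Lemma ext_mapE s : ext_map (ext_pi s) = ext_pi (ext_tmap s).
Proof. by apply/ext_piP/ext_tmap_eq/ext_piP; exact: reprK. Qed.
End ExteriorMap.

Section ExteriorMapMorphism.
Variables (A B : comPzRingType) (M : lmodType A) (N : lmodType B).
Variables (sg : {rmorphism A -> B}) (f : M -> N).

Definition ext_mor (f_lin : forall a x y, f (a *: x + y) = sg a *: f x + f y) :
  exterior M -> exterior N := ext_map sg f.

Hypothesis f_lin : forall a x y, f (a *: x + y) = sg a *: f x + f y.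

Lemma ext_morE s : ext_mor f_lin (ext_pi s) = ext_pi (ext_tmap sg f s).
Proof. exact: ext_mapE. Qed.

Lemma ext_mor_zmod : zmod_morphism (ext_mor f_lin).
Proof.
have D s t : ext_mor f_lin (s + t) = ext_mor f_lin s + ext_mor f_lin t.
  elim/ext_ind: s => s; elim/ext_ind: t => t.
  by rewrite -ext_piD !ext_morE -ext_piD.
by move=> x y; apply/(addIr (ext_mor f_lin y)); rewrite -D !subrK.
Qed.
Lemma ext_mor_monoid : monoid_morphism (ext_mor f_lin).
Proof.
split; first by rewrite ext_morE /= rmorph1.
elim/ext_ind=> s; elim/ext_ind=> t.
by rewrite -ext_piM !ext_morE -ext_piM.
Qed.
HB.instance Definition _ :=
  GRing.isZmodMorphism.Build _ _ (ext_mor f_lin) ext_mor_zmod.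
HB.instance Definition _ :=
  GRing.isMonoidMorphism.Build _ _ (ext_mor f_lin) ext_mor_monoid.

Lemma ext_mor_homog p x : ext_homog p x -> ext_homog p (ext_mor f_lin x).
Proof.
case=> s ps ->; exists (ext_tmap sg f s); last exact: ext_morE.
elim: ps => {p s} /=; rewrite ?rmorph0; by constructor.
Qed.
End ExteriorMapMorphism.

(* The C-linear structure is carried by [pscal]; [ppar U false] and
   [ppar U true] are the even and the odd sections over U. *)
Record superpresheaf (C : numClosedFieldType) (X : topologicalType) :=
  SuperPresheaf {
  psec :> opens X -> pzRingType;
  pscal : forall U, {rmorphism C -> psec U};
  ppar : forall U, bool -> set (psec U);
  pres : forall U V : opens X, V `<=` U -> {rmorphism psec U -> psec V};
  pres_scal : forall (U V : opens X) (h : V `<=` U) c,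
    pres h (pscal U c) = pscal V c;
  pres_par : forall (U V : opens X) (h : V `<=` U) p s,
    ppar p s -> ppar p (pres h s);
  pres_id : forall (U : opens X) (h : U `<=` U) s, pres h s = s;
  pres_comp : forall (U V W : opens X) (h : V `<=` U) (k : W `<=` V)
    (l : W `<=` U) s, pres k (pres h s) = pres l s }.

Arguments pscal {C X} _ U.
Arguments ppar {C X _ U}.
Arguments pres {C X _ U V}.
Arguments pres_scal {C X _ U V}.
Arguments pres_par {C X _ U V}.
Arguments pres_id {C X _ U}.
Arguments pres_comp {C X _ U V W}.

Section ExteriorPresheaf.
Variables (C : numClosedFieldType) (X : topologicalType).
Variables (A : function_sheaf C X) (E : omodule A).

Definition ext_pres (U V : opens X) (h : V `<=` U) :
    {rmorphism exterior (E U) -> exterior (E V)} :=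
  ext_mor (mres_lin (o := E) h).

Definition ext_pscal (U : opens X) : {rmorphism C -> exterior (E U)} :=
  ext_scal (E U) \o rcst A U.

Lemma ext_pres_scal (U V : opens X) (h : V `<=` U) c :
  ext_pres h (ext_pscal U c) = ext_pscal V c.
Proof. by rewrite /= ext_morE /= rres_cst. Qed.
Lemma ext_pres_par (U V : opens X) (h : V `<=` U) p s :
  ext_homog p s -> ext_homog p (ext_pres h s).
Proof. exact: ext_mor_homog. Qed.
Lemma ext_pres_id (U : opens X) (h : U `<=` U) s : ext_pres h s = s.
Proof.
elim/ext_ind: s => s; rewrite /= ext_morE; congr ext_pi.
by elim: s => /= [a|x|s -> t ->|s -> t ->] //; rewrite ?rres_id ?mres_id.
Qed.
Lemma ext_pres_comp (U V W : opens X) (h : V `<=` U) (k : W `<=` V)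
  (l : W `<=` U) s : ext_pres k (ext_pres h s) = ext_pres l s.
Proof.
elim/ext_ind: s => s; rewrite /= !ext_morE; congr ext_pi.
elim: s => /= [a|x|s -> t ->|s -> t ->] //.
  by rewrite (rres_comp h k l).
by rewrite (mres_comp h k l).
Qed.

Definition ext_presheaf : superpresheaf C X :=
  SuperPresheaf ext_pres_scal ext_pres_par ext_pres_id ext_pres_comp.
End ExteriorPresheaf.

Section Stalk.
Variables (C : numClosedFieldType) (X : topologicalType).
Variables (F : superpresheaf C X) (x : X).

Record local_section := LocalSection {
  ls_dom : opens X;
  ls_mem : oset ls_dom x;
  ls_val : F ls_dom }.

Definition same_germ (s t : local_section) :=
  exists (W : opens X) (hs : W `<=` ls_dom s) (ht : W `<=` ls_dom t),
    oset W x /\ pres hs (ls_val s) = pres ht (ls_val t).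

Definition same_germb (s t : {classic local_section}) : bool :=
  `[< same_germ s t >].
Lemma same_germ_refl : reflexive same_germb.
Proof.
move=> s; apply/asboolP; exists (ls_dom s), (@subset_refl _ _), (@subset_refl _ _).
by split=> //; exact: ls_mem.
Qed.
Lemma same_germ_sym : symmetric same_germb.
Proof.
by move=> s t; apply/asboolP/asboolP=> -[W [h [k [Wx e]]]]; exists W, k, h.
Qed.
Lemma same_germ_trans : transitive same_germb.
Proof.
move=> t s u /asboolP[W [h [k [Wx e]]]] /asboolP[W' [h' [k' [Wx' e']]]].
apply/asboolP; pose Z := opensI W W'.
have ZW : Z `<=` W by move=> y [].
have ZW' : Z `<=` W' by move=> y [].
exists Z, (subset_trans ZW h), (subset_trans ZW' k'); split=> //.
rewrite -(pres_comp h ZW) e (pres_comp k ZW (subset_trans ZW k)).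
by rewrite -(pres_comp k' ZW') -e' (pres_comp h' ZW' (subset_trans ZW k)).
Qed.
Canonical same_germ_equiv :=
  EquivRel same_germb same_germ_refl same_germ_sym same_germ_trans.

Definition stalk : Type := {eq_quot same_germb}.
HB.instance Definition _ := Choice.on stalk.

Definition germ (U : opens X) (Ux : oset U x) (s : F U) : stalk :=
  \pi_{eq_quot same_germb} (LocalSection Ux s).

Lemma germP U (Ux : oset U x) (s : F U) V (Vx : oset V x) (t : F V) :
  germ Ux s = germ Vx t <->
  same_germ (LocalSection Ux s) (LocalSection Vx t).
Proof.
by split=> [/eqP|st]; [|apply/eqP]; rewrite /germ piE; [move=> /asboolP|apply/asboolP].
Qed.

Lemma germ_res (U V : opens X) (h : V `<=` U) (Ux : oset U x) (Vx : oset V x)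
  (s : F U) : germ Vx (pres h s) = germ Ux s.
Proof.
apply/germP; exists V, (@subset_refl _ V), h; split=> //=.
by rewrite pres_id.
Qed.

Lemma germ_irr (U : opens X) (Ux Ux' : oset U x) (s : F U) :
  germ Ux s = germ Ux' s.
Proof. by rewrite (Prop_irrelevance Ux Ux'). Qed.

Lemma germ_ind (P : stalk -> Prop) :
  (forall U (Ux : oset U x) (s : F U), P (germ Ux s)) -> forall a, P a.
Proof. by move=> H; elim/quotW=> -[U Ux s]; exact: H. Qed.

Lemma germ_ind2 (P : stalk -> stalk -> Prop) :
  (forall U (Ux : oset U x) (s t : F U), P (germ Ux s) (germ Ux t)) ->
  forall a b, P a b.
Proof.
move=> H; elim/germ_ind=> U Ux s; elim/germ_ind=> V Vx t.
have Zx : oset (opensI U V) x by [].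
have ZU : opensI U V `<=` U by move=> y [].
have ZV : opensI U V `<=` V by move=> y [].
by rewrite -(germ_res ZU Ux Zx) -(germ_res ZV Vx Zx); exact: H.
Qed.

Lemma germ_ind3 (P : stalk -> stalk -> stalk -> Prop) :
  (forall U (Ux : oset U x) (s t u : F U), P (germ Ux s) (germ Ux t) (germ Ux u)) ->
  forall a b c, P a b c.
Proof.
move=> H; apply: (@germ_ind2 (fun a b => forall c, P a b c)) => U Ux s t.
elim/germ_ind=> V Vx u.
have Zx : oset (opensI U V) x by [].
have ZU : opensI U V `<=` U by move=> y [].
have ZV : opensI U V `<=` V by move=> y [].
by rewrite -!(germ_res ZU Ux Zx) -(germ_res ZV Vx Zx); exact: H.
Qed.

Let rep (a : stalk) : local_section := repr (a : {eq_quot same_germb}).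
Let dom2 (a b : stalk) : opens X := opensI (ls_dom (rep a)) (ls_dom (rep b)).
Let dom2x a b : oset (dom2 a b) x := conj (ls_mem (rep a)) (ls_mem (rep b)).
Let res1 a b : F (dom2 a b) :=
  pres (fun y (h : oset (dom2 a b) y) => proj1 h) (ls_val (rep a)).
Let res2 a b : F (dom2 a b) :=
  pres (fun y (h : oset (dom2 a b) y) => proj2 h) (ls_val (rep b)).

Definition stalk_op (op : forall U, F U -> F U -> F U) (a b : stalk) : stalk :=
  germ (dom2x a b) (op _ (res1 a b) (res2 a b)).
Definition stalk_opp (a : stalk) : stalk :=
  germ (ls_mem (rep a)) (- ls_val (rep a)).

Let repK (a : stalk) : germ (ls_mem (rep a)) (ls_val (rep a)) = a.
Proof. by rewrite -[RHS](reprK (a : {eq_quot same_germb})) /germ /rep; case: repr. Qed.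

Lemma stalk_opE (op : forall U, F U -> F U -> F U)
    (opres : forall (U V : opens X) (h : V `<=` U) s t,
      pres h (op _ s t) = op _ (pres h s) (pres h t)) U (Ux : oset U x) s t :
  stalk_op op (germ Ux s) (germ Ux t) = germ Ux (op _ s t).
Proof.
set a := germ Ux s; set b := germ Ux t.
have /germP[W [ha [hs [/= Wx ea]]]] : germ (ls_mem (rep a)) (ls_val (rep a)) =
  germ Ux s by rewrite repK.
have /germP[W' [hb [ht [/= Wx' eb]]]] : germ (ls_mem (rep b)) (ls_val (rep b)) =
  germ Ux t by rewrite repK.
pose Z := opensI W W'.
have ZW : Z `<=` W by move=> y [].
have ZW' : Z `<=` W' by move=> y [].
have ZU : Z `<=` U := subset_trans ZW hs.
have Zd : Z `<=` dom2 a b by move=> y [/ha ? /hb ?].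
apply/germP; exists Z, Zd, ZU; split=> //=; rewrite !opres; congr (op _ _ _).
  rewrite /res1 (pres_comp _ Zd (subset_trans ZW ha)).
  by rewrite -(pres_comp ha ZW) ea (pres_comp hs ZW ZU).
rewrite /res2 (pres_comp _ Zd (subset_trans ZW' hb)).
by rewrite -(pres_comp hb ZW') eb (pres_comp ht ZW' ZU).
Qed.

Definition stalk_add := stalk_op (fun U => +%R).
Definition stalk_mul := stalk_op (fun U => *%R).
Let addE U (Ux : oset U x) s t :
  stalk_add (germ Ux s) (germ Ux t) = germ Ux (s + t).
Proof. by apply: stalk_opE => *; rewrite rmorphD. Qed.
Let mulE U (Ux : oset U x) s t :
  stalk_mul (germ Ux s) (germ Ux t) = germ Ux (s * t).
Proof. by apply: stalk_opE => *; rewrite rmorphM. Qed.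
Let oppE U (Ux : oset U x) s : stalk_opp (germ Ux s) = germ Ux (- s).
Proof.
rewrite /stalk_opp; set a := germ Ux s.
have /germP[W [h [k [Wx e]]]] : germ (ls_mem (rep a)) (ls_val (rep a)) =
  germ Ux s by rewrite repK.
by apply/germP; exists W, h, k; split=> //=; rewrite !rmorphN; congr -%R.
Qed.

Definition stalk_zero : stalk := @germ (opensT X) I 0.
Definition stalk_one : stalk := @germ (opensT X) I 1.
Let zeroE U (Ux : oset U x) : stalk_zero = germ Ux 0.
Proof.
have UT : U `<=` opensT X by [].
by rewrite /stalk_zero -(germ_res UT I Ux) rmorph0.
Qed.
Let oneE U (Ux : oset U x) : stalk_one = germ Ux 1.
Proof.
have UT : U `<=` opensT X by [].
by rewrite /stalk_one -(germ_res UT I Ux) rmorph1.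
Qed.

Lemma stalk_addA : associative stalk_add.
Proof. by apply: germ_ind3 => U Ux s t u; rewrite !addE addrA. Qed.
Lemma stalk_addC : commutative stalk_add.
Proof. by apply: germ_ind2 => U Ux s t; rewrite !addE addrC. Qed.
Lemma stalk_add0 : left_id stalk_zero stalk_add.
Proof. by elim/germ_ind=> U Ux s; rewrite (zeroE Ux) addE add0r. Qed.
Lemma stalk_addN : left_inverse stalk_zero stalk_opp stalk_add.
Proof. by elim/germ_ind=> U Ux s; rewrite (zeroE Ux) oppE addE addNr. Qed.
Lemma stalk_mulA : associative stalk_mul.
Proof. by apply: germ_ind3 => U Ux s t u; rewrite !mulE mulrA. Qed.
Lemma stalk_mul1 : left_id stalk_one stalk_mul.
Proof. by elim/germ_ind=> U Ux s; rewrite (oneE Ux) mulE mul1r. Qed.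
Lemma stalk_mulr1 : right_id stalk_one stalk_mul.
Proof. by elim/germ_ind=> U Ux s; rewrite (oneE Ux) mulE mulr1. Qed.
Lemma stalk_mulDl : left_distributive stalk_mul stalk_add.
Proof. by apply: germ_ind3 => U Ux s t u; rewrite !(addE, mulE) mulrDl. Qed.
Lemma stalk_mulDr : right_distributive stalk_mul stalk_add.
Proof. by apply: germ_ind3 => U Ux s t u; rewrite !(addE, mulE) mulrDr. Qed.

HB.instance Definition _ := GRing.isPzRing.Build stalk stalk_addA stalk_addC
  stalk_add0 stalk_addN stalk_mulA stalk_mul1 stalk_mulr1 stalk_mulDl
  stalk_mulDr.

Section Germ.
Variables (U : opens X) (Ux : oset U x).
Lemma germ_zmod : zmod_morphism (germ Ux).
Proof.
move=> s t; rewrite -[- germ Ux t]/(stalk_opp _) oppE.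
by rewrite -[RHS]/(stalk_add _ _) addE.
Qed.
Lemma germ_monoid : monoid_morphism (germ Ux).
Proof.
split=> [|s t]; first by rewrite -oneE.
by rewrite -[RHS]/(stalk_mul _ _) mulE.
Qed.
HB.instance Definition _ :=
  GRing.isZmodMorphism.Build (F U) stalk (germ Ux) germ_zmod.
HB.instance Definition _ :=
  GRing.isMonoidMorphism.Build (F U) stalk (germ Ux) germ_monoid.
End Germ.

Definition stalk_par (p : bool) : set stalk :=
  [set a | exists (U : opens X) (Ux : oset U x) (s : F U),
    ppar p s /\ a = germ Ux s].
End Stalk.

Section ProductRing.
Variables (I : Type) (R : I -> pzRingType).

Definition dprod : Type := forall i, R i.
HB.instance Definition _ := gen_eqMixin dprod.
HB.instance Definition _ := gen_choiceMixin dprod.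

Let padd (s t : dprod) : dprod := fun i => s i + t i.
Let popp (s : dprod) : dprod := fun i => - s i.
Let pmul (s t : dprod) : dprod := fun i => s i * t i.
Let pzero : dprod := fun i => 0.
Let pone : dprod := fun i => 1.

Lemma paddA : associative padd.
Proof. by move=> a b c; apply: functional_extensionality_dep => i; exact: addrA. Qed.
Lemma paddC : commutative padd.
Proof. by move=> a b; apply: functional_extensionality_dep => i; exact: addrC. Qed.
Lemma padd0 : left_id pzero padd.
Proof. by move=> a; apply: functional_extensionality_dep => i; exact: add0r. Qed.
Lemma paddN : left_inverse pzero popp padd.
Proof. by move=> a; apply: functional_extensionality_dep => i; exact: addNr. Qed.
Lemma pmulA : associative pmul.
Proof. by move=> a b c; apply: functional_extensionality_dep => i; exact: mulrA. Qed.
Lemma pmul1 : left_id pone pmul.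
Proof. by move=> a; apply: functional_extensionality_dep => i; exact: mul1r. Qed.
Lemma pmulr1 : right_id pone pmul.
Proof. by move=> a; apply: functional_extensionality_dep => i; exact: mulr1. Qed.
Lemma pmulDl : left_distributive pmul padd.
Proof. by move=> a b c; apply: functional_extensionality_dep => i; exact: mulrDl. Qed.
Lemma pmulDr : right_distributive pmul padd.
Proof. by move=> a b c; apply: functional_extensionality_dep => i; exact: mulrDr. Qed.
HB.instance Definition _ := GRing.isPzRing.Build dprod paddA paddC padd0 paddN
  pmulA pmul1 pmulr1 pmulDl pmulDr.
End ProductRing.

(* Sheafification: families of germs that come locally from sections. *)
Section Sheafification.
Variables (C : numClosedFieldType) (X : topologicalType).
Variable (F : superpresheaf C X).

Section OnOpen.
Variable U : opens X.

Definition germs : pzRingType := dprod (fun x : U => stalk F (val x)).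

Lemma germs_irr (s : germs) y (p q : y \in oset U) :
  s (exist _ y p) = s (exist _ y q) :> stalk F y.
Proof. by rewrite (bool_irrelevance p q). Qed.

Definition loc_rep (s : germs) (x : U) :=
  exists (V : opens X) (h : V `<=` U) (t : F V), oset V (val x) /\
    forall y (Vy : oset V y), s (incl h (exist _ y (mem_set Vy))) = germ Vy t.

Definition locally_represented : {pred germs} :=
  fun s => `[< forall x : U, loc_rep s x >].

Lemma locally_represented_subring : subring_closed locally_represented.
Proof.
have two (s t : germs) (x : U) : loc_rep s x -> loc_rep t x ->
    exists (V : opens X) (h : V `<=` U) (a b : F V), oset V (val x) /\
      forall y (Vy : oset V y),
        s (incl h (exist _ y (mem_set Vy))) = germ Vy a /\
        t (incl h (exist _ y (mem_set Vy))) = germ Vy b.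
  move=> [V [h [a [Vx ea]]]] [W [k [b [Wx eb]]]]; pose Z := opensI V W.
  have ZV : Z `<=` V by move=> y [].
  have ZW : Z `<=` W by move=> y [].
  exists Z, (subset_trans ZV h), (pres ZV a), (pres ZW b).
  split=> // y Zy; rewrite (germ_res ZV (ZV _ Zy)) (germ_res ZW (ZW _ Zy)).
  by rewrite -ea -eb; split; exact: germs_irr.
split.
- apply/asboolP=> x; have Ux : oset U (val x) := set_mem (valP x).
  exists U, (@subset_refl _ _), 1; split=> // y Uy.
  by rewrite rmorph1.
- move=> s t /asboolP rs /asboolP rt; apply/asboolP=> x.
  have [V [h [a [b [Vx e]]]]] := two _ _ _ (rs x) (rt x).
  exists V, h, (a - b); split=> // y Vy; have [ea eb] := e y Vy.
  by rewrite rmorphB; exact: (congr2 (fun u v => u - v) ea eb).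
- move=> s t /asboolP rs /asboolP rt; apply/asboolP=> x.
  have [V [h [a [b [Vx e]]]]] := two _ _ _ (rs x) (rt x).
  exists V, h, (a * b); split=> // y Vy; have [ea eb] := e y Vy.
  by rewrite rmorphM; exact: (congr2 (fun u v => u * v) ea eb).
Qed.

Record shsec := ShSec { shval : germs; shvalP : shval \in locally_represented }.
HB.instance Definition _ := [isSub for shval].
HB.instance Definition _ := [Choice of shsec by <:].
HB.instance Definition _ := GRing.SubChoice_isSubPzRing.Build germs
  locally_represented shsec locally_represented_subring.

Lemma shsecP (s t : shsec) : (forall x, shval s x = shval t x) -> s = t.
Proof. by move=> st; apply/val_inj/functional_extensionality_dep. Qed.

Lemma of_presheaf_subproof (t : F U) :
  ((fun x => germ (set_mem (valP x)) t) : germs) \in locally_represented.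
Proof.
apply/asboolP=> x; exists U, (@subset_refl _ _), t; split=> [|y Uy].
  exact: set_mem (valP x).
exact: germ_irr.
Qed.

Definition of_presheaf (t : F U) : shsec := ShSec (of_presheaf_subproof t).

Lemma of_presheaf_zmod : zmod_morphism of_presheaf.
Proof. by move=> s t; apply: shsecP => x; exact: rmorphB. Qed.
Lemma of_presheaf_monoid : monoid_morphism of_presheaf.
Proof.
split=> [|s t]; apply: shsecP => x; [exact: rmorph1|exact: rmorphM].
Qed.
HB.instance Definition _ :=
  GRing.isZmodMorphism.Build (F U) shsec of_presheaf of_presheaf_zmod.
HB.instance Definition _ :=
  GRing.isMonoidMorphism.Build (F U) shsec of_presheaf of_presheaf_monoid.

Definition shscal : {rmorphism C -> shsec} := of_presheaf \o pscal F U.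

Definition shpar (p : bool) : set shsec :=
  [set s | forall x : U, stalk_par p (shval s x)].
End OnOpen.

Section Restrict.
Variables (U V : opens X) (h : V `<=` U).

Lemma shres_subproof (s : shsec U) :
  ((fun x : V => shval s (incl h x)) : germs V) \in @locally_represented V.
Proof.
apply/asboolP=> x; have /asboolP/(_ (incl h x))[W [k [t [/= Wx e]]]] := shvalP s.
pose Z := opensI W V.
have ZW : Z `<=` W by move=> y [].
have ZV : Z `<=` V by move=> y [].
exists Z, ZV, (pres ZW t); split=> [|y Zy].
  by split=> //; exact: set_mem (valP x).
rewrite (germ_res ZW (ZW _ Zy)) -e; exact: germs_irr.
Qed.

Definition shres (s : shsec U) : shsec V := ShSec (shres_subproof s).

Lemma shres_zmod : zmod_morphism shres.
Proof. by move=> s t; apply: shsecP. Qed.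
Lemma shres_monoid : monoid_morphism shres.
Proof. by split=> [|s t]; apply: shsecP. Qed.
HB.instance Definition _ :=
  GRing.isZmodMorphism.Build (shsec U) (shsec V) shres shres_zmod.
HB.instance Definition _ :=
  GRing.isMonoidMorphism.Build (shsec U) (shsec V) shres shres_monoid.
End Restrict.

Lemma shres_scal (U V : opens X) (h : V `<=` U) c :
  (shres h : {rmorphism _ -> _}) (shscal U c) = shscal V c.
Proof.
apply: shsecP => x /=.
by rewrite -(pres_scal h c) (germ_res h (h _ (set_mem (valP x)))); exact: germ_irr.
Qed.
Lemma shres_par (U V : opens X) (h : V `<=` U) p s :
  shpar p s -> shpar p ((shres h : {rmorphism _ -> _}) s).
Proof. by move=> ps x; exact: (ps (incl h x)). Qed.
Lemma shres_id (U : opens X) (h : U `<=` U) s :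
  (shres h : {rmorphism _ -> _}) s = s.
Proof. by apply: shsecP => -[y q]; exact: (@germs_irr U (shval s) y). Qed.
Lemma shres_comp (U V W : opens X) (h : V `<=` U) (k : W `<=` V)
  (l : W `<=` U) s :
  (shres k : {rmorphism _ -> _}) ((shres h : {rmorphism _ -> _}) s) =
  (shres l : {rmorphism _ -> _}) s.
Proof. by apply: shsecP => -[y q]; exact: (@germs_irr U (shval s) y). Qed.

Definition sheafify : superpresheaf C X :=
  SuperPresheaf shres_scal shres_par shres_id shres_comp.
End Sheafification.

Record superspace (C : numClosedFieldType) := Superspace {
  spt :> topologicalType;
  ssheaf : superpresheaf C spt }.

Definition split_superspace (C : numClosedFieldType) (X : topologicalType)
    (A : function_sheaf C X) (E : omodule A) : superspace C :=
  Superspace (sheafify (ext_presheaf E)).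

Lemma differentiable_near (K : numFieldType) (V W : normedModType K)
    (x : V) (f g : V -> W) :
  (\forall y \near x, f y = g y) -> differentiable f x -> differentiable g x.
Proof.
move=> fg /diff_locallyP[dc df].
have gx : g x = f x by rewrite (nbhs_singleton fg).
have dg : g \o shift x = cst (g x) + 'd f x +o_ 0 id.
  apply/eqaddoP => e e0; have /eqaddoP/(_ e e0) := df.
  have : \forall h \near (0 : V), f (h + x) = g (h + x).
    by move: fg; rewrite (near_shift 0) subr0.
  rewrite gx; apply: filterS2 => h /= fgh.
  by rewrite !fctE /= fgh.
apply/diff_locallyP; rewrite (diff_unique dc dg).
by split.
Qed.

Section FunctionSheaves.
Variable C : numClosedFieldType.

Section Affine.
Variable p : nat.

Definition holomorphic_at (x : 'rV[C]_p) (f : 'rV[C]_p -> C) :=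
  \forall y \near x, differentiable f y.

Lemma holomorphic_near x f g : (\forall y \near x, f y = g y) ->
  holomorphic_at x f -> holomorphic_at x g.
Proof.
by move=> /near_join; apply: filterS2 => y fg; exact: differentiable_near.
Qed.
Lemma holomorphic_open x f : holomorphic_at x f ->
  \forall y \near x, holomorphic_at y f.
Proof. exact: near_join. Qed.
Lemma holomorphic_cst x (c : C) : holomorphic_at x (cst c).
Proof. by near=> y; exact: differentiable_cst. Unshelve. all: by end_near. Qed.
Lemma holomorphicB x f g : holomorphic_at x f -> holomorphic_at x g ->
  holomorphic_at x (f \- g).
Proof. by apply: filterS2 => y; exact: differentiableB. Qed.
Lemma holomorphicM x f g : holomorphic_at x f -> holomorphic_at x g ->
  holomorphic_at x (f \* g).
Proof. by apply: filterS2 => y; exact: differentiableM. Qed.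

Definition affine_sheaf : function_sheaf C 'rV[C]_p :=
  FunctionSheaf holomorphic_near holomorphic_open holomorphic_cst
    holomorphicB holomorphicM.
End Affine.

(* The restriction of a sheaf of functions to an (open) subspace. *)
Section Subspace.
Variables (X : topologicalType) (A : function_sheaf C X) (Y : set X).

Definition sub_hol (v : Y) (f : Y -> C) :=
  exists2 F : X -> C, hol A (val v) F & \forall w \near v, f w = F (val w).

Lemma sub_hol_near v f g : (\forall y \near v, f y = g y) ->
  sub_hol v f -> sub_hol v g.
Proof.
move=> fg [F hF fF]; exists F => //.
by move: fg fF; apply: filterS2 => w <-.
Qed.
Lemma sub_hol_open v f : sub_hol v f -> \forall w \near v, sub_hol w f.
Proof.
move=> [F hF /near_join fF].
have /(@initial_continuous _ _ set_val v) : \forall y \near val v, hol A y F.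
  exact: hol_open.
by move: fF; rewrite near_simpl; apply: filterS2 => w fF hw; exists F.
Qed.
Lemma sub_hol_cst v (c : C) : sub_hol v (cst c).
Proof. by exists (cst c); [exact: hol_cst|near=> w]. Unshelve. all: by end_near. Qed.
Lemma sub_holB v f g : sub_hol v f -> sub_hol v g -> sub_hol v (f \- g).
Proof.
move=> [F hF fF] [G hG gG]; exists (F \- G); first exact: holB.
by move: fF gG; apply: filterS2 => w /= -> ->.
Qed.
Lemma sub_holM v f g : sub_hol v f -> sub_hol v g -> sub_hol v (f \* g).
Proof.
move=> [F hF fF] [G hG gG]; exists (F \* G); first exact: holM.
by move: fF gG; apply: filterS2 => w /= -> ->.
Qed.

Definition sub_sheaf : function_sheaf C Y :=
  FunctionSheaf sub_hol_near sub_hol_open sub_hol_cst sub_holB sub_holM.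
End Subspace.

(* The quotient of a space with functions: f is a section near q when its
   pullback is a section at every point lying over a neighbourhood of q. *)
Section Quotient.
Variables (X : topologicalType) (A : function_sheaf C X) (Q0 : quotType X).
Local Notation Q := (quotient_topology Q0).
Local Notation pr := (\pi_Q : X -> Q).

Definition quot_hol (q : Q) (f : Q -> C) :=
  \forall q' \near q, forall v : X, pr v = q' -> hol A v (f \o pr).

Lemma quot_hol_near q f g : (\forall y \near q, f y = g y) ->
  quot_hol q f -> quot_hol q g.
Proof.
move=> /near_join; apply: filterS2 => y fg hf v vy.
apply: hol_near (hf v vy); subst y.
by have /= := @pi_continuous _ Q0 v _ fg.
Qed.
Lemma quot_hol_open q f : quot_hol q f -> \forall y \near q, quot_hol y f.
Proof. exact: near_join. Qed.
Lemma quot_hol_cst q (c : C) : quot_hol q (cst c).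
Proof. by near=> y => v _; exact: hol_cst. Unshelve. all: by end_near. Qed.
Lemma quot_holB q f g : quot_hol q f -> quot_hol q g -> quot_hol q (f \- g).
Proof.
by apply: filterS2 => y hf hg v vy; exact: holB (hf v vy) (hg v vy).
Qed.
Lemma quot_holM q f g : quot_hol q f -> quot_hol q g -> quot_hol q (f \* g).
Proof.
by apply: filterS2 => y hf hg v vy; exact: holM (hf v vy) (hg v vy).
Qed.

Definition quot_sheaf : function_sheaf C Q :=
  FunctionSheaf quot_hol_near quot_hol_open quot_hol_cst quot_holB quot_holM.
End Quotient.
End FunctionSheaves.

Section ProjectiveSpace.
Variables (C : numClosedFieldType) (m : nat).

Definition punctured : Type := [set x : 'rV[C]_m.+1 | x != 0].
HB.instance Definition _ := Topological.on punctured.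

Definition punctured_sheaf : function_sheaf C punctured :=
  sub_sheaf (affine_sheaf C m.+1) [set x | x != 0].

Definition proportional (v w : punctured) : bool :=
  `[< exists2 l : C, l != 0 & val w = l *: val v >].

Lemma proportional_refl : reflexive proportional.
Proof. by move=> v; apply/asboolP; exists 1; rewrite ?oner_neq0 ?scale1r. Qed.
Lemma proportional_sym : symmetric proportional.
Proof.
have H v w : proportional v w -> proportional w v.
  move=> /asboolP[l l0 e]; apply/asboolP; exists l^-1; rewrite ?invr_neq0 //.
  by rewrite e scalerA mulVf // scale1r.
by move=> v w; apply/idP/idP; exact: H.
Qed.
Lemma proportional_trans : transitive proportional.
Proof.
move=> w v u /asboolP[l l0 e] /asboolP[k k0 e']; apply/asboolP.
by exists (k * l); rewrite ?mulf_neq0 // e' e scalerA.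
Qed.
Canonical proportional_equiv :=
  EquivRel proportional proportional_refl proportional_sym proportional_trans.

Definition projective_space : Type :=
  quotient_topology {eq_quot proportional}.
HB.instance Definition _ := Topological.on projective_space.

Definition proj (v : punctured) : projective_space :=
  \pi_(quotient_topology {eq_quot proportional}) v.

Lemma projP v w :
  proj v = proj w <-> exists2 l : C, l != 0 & val w = l *: val v.
Proof.
rewrite /proj -[X in X <-> _]/(\pi_{eq_quot proportional} v =
  \pi_{eq_quot proportional} w).
by split=> [/eqmodP/asboolP|h]; last by apply/eqmodP/asboolP.
Qed.

Lemma proj_continuous : continuous proj.
Proof. exact: pi_continuous. Qed.

Definition projective_sheaf : function_sheaf C projective_space :=
  quot_sheaf punctured_sheaf {eq_quot proportional}.

Definition cone (U : opens projective_space) : opens punctured :=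
  opreim proj_continuous U.
End ProjectiveSpace.

Section TwistingSheaves.
Variables (C : numClosedFieldType) (m : nat).
Local Notation P := (projective_space C m).
Local Notation OP := (projective_sheaf C m).
Local Notation OV := (punctured_sheaf C m).

Definition cone_proj (U : opens P) (v : cone U) : U :=
  exist _ (proj (val v)) (valP v).

Section Pullback.
Variable U : opens P.

Lemma pullback_subproof (f : regfun OP U) :
  (fun v : cone U => f (cone_proj v)) \in regular OV (cone U).
Proof.
have [F hF fF] := rfunE f; apply/asboolP; exists (F \o @proj C m) => [v Uv|v].
  exact: nbhs_singleton (hF _ Uv) v erefl.
exact: fF.
Qed.

Definition pullback (f : regfun OP U) : regfun OV (cone U) :=
  Regfun (pullback_subproof f).

Lemma pullback_zmod : zmod_morphism pullback.
Proof. by move=> f g; exact: regfunP. Qed.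
Lemma pullback_monoid : monoid_morphism pullback.
Proof. by split=> [|f g]; exact: regfunP. Qed.
HB.instance Definition _ := GRing.isZmodMorphism.Build (regfun OP U)
  (regfun OV (cone U)) pullback pullback_zmod.
HB.instance Definition _ := GRing.isMonoidMorphism.Build (regfun OP U)
  (regfun OV (cone U)) pullback pullback_monoid.
End Pullback.

(* O(k): functions on the cone that are homogeneous of degree k. *)
Section Homogeneous.
Variables (k : int) (U : opens P).

Definition homogeneous : {pred regfun OV (cone U)} := fun s =>
  `[< forall (l : C) (v w : cone U), l != 0 ->
      val (val w) = l *: val (val v) -> s w = l ^ k * s v >].

Lemma homogeneous_zmod : zmod_closed homogeneous.
Proof.
split=> [|s t /asboolP hs /asboolP ht]; apply/asboolP=> l v w l0 e.
  by rewrite rfun0 rfun0 mulr0.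
by rewrite rfunB (hs l v w) // (ht l v w) // rfunB mulrBr.
Qed.

Record twist_sec := TwistSec {
  twist_val : regfun OV (cone U);
  twist_valP : twist_val \in homogeneous }.
HB.instance Definition _ := [isSub for twist_val].
HB.instance Definition _ := [Choice of twist_sec by <:].
HB.instance Definition _ := GRing.SubChoice_isSubZmodule.Build
  (regfun OV (cone U)) homogeneous twist_sec homogeneous_zmod.

Lemma twist_scale_subproof (f : regfun OP U) (s : twist_sec) :
  pullback f * twist_val s \in homogeneous.
Proof.
apply/asboolP=> l v w l0 e; have /asboolP hs := twist_valP s.
rewrite !rfunM (hs l v w) // mulrCA; congr (_ * (_ * _)).
congr (rfun f _); apply: val_inj => /=.
by apply/esym/projP; exists l.
Qed.

Definition twist_scale (f : regfun OP U) (s : twist_sec) : twist_sec :=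
  TwistSec (twist_scale_subproof f s).

Lemma twist_scaleA a b v : twist_scale a (twist_scale b v) = twist_scale (a * b) v.
Proof. by apply: val_inj; rewrite /= rmorphM mulrA. Qed.
Lemma twist_scale1 : left_id 1 twist_scale.
Proof. by move=> v; apply: val_inj; rewrite /= rmorph1 mul1r. Qed.
Lemma twist_scaleDr : right_distributive twist_scale +%R.
Proof. by move=> a v w; apply: val_inj; exact: mulrDr. Qed.
Lemma twist_scaleDl v : {morph twist_scale^~ v : a b / a + b}.
Proof. by move=> a b; apply: val_inj; rewrite /= rmorphD; exact: mulrDl. Qed.
HB.instance Definition _ := GRing.Zmodule_isLmodule.Build (regfun OP U)
  twist_sec twist_scaleA twist_scale1 twist_scaleDr twist_scaleDl.
End Homogeneous.
Arguments homogeneous k U : clear implicits.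

Lemma cone_sub (U V : opens P) : V `<=` U -> cone V `<=` cone U.
Proof. by move=> h v; exact: h. Qed.

Section TwistRestriction.
Variable k : int.

Lemma twist_res_subproof (U V : opens P) (h : V `<=` U) (s : twist_sec k U) :
  rres (cone_sub h) (twist_val s) \in homogeneous k V.
Proof.
have /asboolP hs := twist_valP s; apply/asboolP=> l v w l0 e.
exact: hs.
Qed.

Definition twist_res (U V : opens P) (h : V `<=` U) (s : twist_sec k U) :
  twist_sec k V := TwistSec (twist_res_subproof h s).

Lemma twist_res_lin (U V : opens P) (h : V `<=` U) a s t :
  twist_res h (a *: s + t) = rres h a *: twist_res h s + twist_res h t.
Proof.
apply: val_inj; apply: regfunP => v; set w := incl (cone_sub h) v.
rewrite -[LHS]/(a (cone_proj w) * twist_val s w + twist_val t w).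
rewrite -[RHS]/(a (incl h (cone_proj v)) * twist_val s w + twist_val t w).
by congr (rfun a _ * _ + _); exact: val_inj.
Qed.
Lemma twist_res_id (U : opens P) (h : U `<=` U) s : twist_res h s = s.
Proof. by apply: val_inj; exact: rres_id. Qed.
Lemma twist_res_comp (U V W : opens P) (h : V `<=` U) (k' : W `<=` V)
  (l : W `<=` U) s : twist_res k' (twist_res h s) = twist_res l s.
Proof. by apply: val_inj; exact: rres_comp. Qed.

Definition twisting_sheaf : omodule OP :=
  OModule twist_res_lin twist_res_id twist_res_comp.
End TwistRestriction.
End TwistingSheaves.

Section ProjectiveSuperspace.
Variables (C : numClosedFieldType) (m n : nat) (b : 'I_n -> int).
Local Notation P := (projective_space C m).
Local Notation OV := (punctured_sheaf C m).

(* Functions on the open sub-superspace of C^(m+1|n) over the cone of U that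
   are fixed by x |-> l x, theta_a |-> l^(b a) theta_a for all l != 0: the
   pullback of \sum_I g I(x) theta_I is
   \sum_I g I(l x) (\prod_(a in I) l^(b a)) theta_I. *)
Definition invariant (U : opens P) :
    {pred grassmann n (regfun OV (cone U))} := fun g =>
  `[< forall (l : C) (v w : cone U), l != 0 ->
      val (val w) = l *: val (val v) ->
      forall I : {set 'I_n}, (\prod_(a in I) l ^ b a) * g I w = g I v >].

Section OnOpen.
Variable U : opens P.

Lemma invariant_subring : subring_closed (@invariant U).
Proof.
split.
- apply/asboolP=> l v w l0 e I; rewrite ffunE; case: eqP => [->|_].
    by rewrite finset.big_set0 mul1r.
  by rewrite !rfun0 mulr0.
- move=> f g /asboolP hf /asboolP hg; apply/asboolP=> l v w l0 e I.
  by rewrite !ffunE !rfunB mulrBr (hf l v w) // (hg l v w).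
- move=> f g /asboolP hf /asboolP hg; apply/asboolP=> l v w l0 e K.
  have ev (x : cone U) (r : seq {set 'I_n}) (p : pred {set 'I_n})
      (G : {set 'I_n} -> regfun OV (cone U)) :
    rfun (\sum_(I <- r | p I) G I) x = \sum_(I <- r | p I) G I x.
    by elim/big_rec2: _ => [|I y z _ <-]; rewrite ?rfun0 ?rfunD.
  rewrite !ffunE !ev mulr_sumr; apply: eq_bigr => I IK.
  rewrite !rfunM -(hf l v w) // -(hg l v w) //.
  have sgn : forall k : nat, rfun ((-1) ^+ k : regfun OV (cone U)) w =
      rfun ((-1) ^+ k : regfun OV (cone U)) v.
    by elim=> // k IH; rewrite !exprS !rfunM IH.
  rewrite sgn mulrCA; congr (_ * _); rewrite mulrACA; congr (_ * _).
  rewrite (big_setID I) /= (finset.setIidPr IK).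
  by [].
Qed.

Record ps_sec := PsSec {
  ps_val : grassmann n (regfun OV (cone U));
  ps_valP : ps_val \in @invariant U }.
HB.instance Definition _ := [isSub for ps_val].
HB.instance Definition _ := [Choice of ps_sec by <:].
HB.instance Definition _ := GRing.SubChoice_isSubPzRing.Build
  (grassmann n (regfun OV (cone U))) (@invariant U) ps_sec invariant_subring.

Lemma ps_cst_subproof c : gscal n (rcst OV (cone U) c) \in @invariant U.
Proof.
apply/asboolP=> l v w l0 e I; rewrite ffunE; case: eqP => [->|_].
  by rewrite finset.big_set0 mul1r.
by rewrite !rfun0 mulr0.
Qed.
Definition ps_cst (c : C) : ps_sec := PsSec (ps_cst_subproof c).
Lemma ps_cst_zmod : zmod_morphism ps_cst.
Proof. by move=> c d; apply: val_inj; rewrite /= !rmorphB. Qed.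
Lemma ps_cst_monoid : monoid_morphism ps_cst.
Proof. by split=> [|c d]; apply: val_inj; rewrite /= ?rmorph1 ?rmorphM. Qed.
HB.instance Definition _ :=
  GRing.isZmodMorphism.Build C ps_sec ps_cst ps_cst_zmod.
HB.instance Definition _ :=
  GRing.isMonoidMorphism.Build C ps_sec ps_cst ps_cst_monoid.

Definition ps_par (p : bool) : set ps_sec := [set g | ghomog p (ps_val g)].
End OnOpen.

Section Restriction.
Variables (U V : opens P) (h : V `<=` U).

Lemma ps_res_subproof (g : ps_sec U) :
  gmap (rres (cone_sub h)) (ps_val g) \in @invariant V.
Proof.
have /asboolP hg := ps_valP g; apply/asboolP=> l v w l0 e I.
by rewrite !ffunE; exact: hg.
Qed.
Definition ps_res (g : ps_sec U) : ps_sec V := PsSec (ps_res_subproof g).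
Lemma ps_res_zmod : zmod_morphism ps_res.
Proof. by move=> f g; apply: val_inj; rewrite /= !rmorphB. Qed.
Lemma ps_res_monoid : monoid_morphism ps_res.
Proof. by split=> [|f g]; apply: val_inj; rewrite /= ?rmorph1 ?rmorphM. Qed.
HB.instance Definition _ :=
  GRing.isZmodMorphism.Build (ps_sec U) (ps_sec V) ps_res ps_res_zmod.
HB.instance Definition _ :=
  GRing.isMonoidMorphism.Build (ps_sec U) (ps_sec V) ps_res ps_res_monoid.
End Restriction.

Definition ps_scal (U : opens P) : {rmorphism C -> ps_sec U} := @ps_cst U.
Definition ps_pres (U V : opens P) (h : V `<=` U) :
  {rmorphism ps_sec U -> ps_sec V} := ps_res h.

Lemma ps_pres_scal (U V : opens P) (h : V `<=` U) c :
  ps_pres h (ps_scal U c) = ps_scal V c.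
Proof.
apply: val_inj; apply/ffunP => I /=; rewrite !ffunE; case: eqP => _.
  exact: rres_cst.
exact: rmorph0.
Qed.
Lemma ps_pres_par (U V : opens P) (h : V `<=` U) p g :
  ps_par p g -> ps_par p (ps_pres h g).
Proof. by move=> pg I oI; rewrite ffunE (pg I oI) rmorph0. Qed.
Lemma ps_pres_id (U : opens P) (h : U `<=` U) g : ps_pres h g = g.
Proof. by apply: val_inj; apply/ffunP => I /=; rewrite ffunE; exact: rres_id. Qed.
Lemma ps_pres_comp (U V W : opens P) (h : V `<=` U) (k : W `<=` V)
  (l : W `<=` U) g : ps_pres k (ps_pres h g) = ps_pres l g.
Proof.
apply: val_inj; apply/ffunP => I /=; rewrite !ffunE.
exact: rres_comp.
Qed.

Definition projective_superspace : superspace C :=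
  Superspace (SuperPresheaf ps_pres_scal ps_pres_par ps_pres_id ps_pres_comp).
End ProjectiveSuperspace.

Section Supermanifolds.
Variable C : numClosedFieldType.

(* Complex manifolds as spaces with a sheaf of functions, locally isomorphic
   to open subsets of C^p with their holomorphic functions. *)
Definition complex_manifold (X : topologicalType) (A : function_sheaf C X) :=
  [/\ hausdorff_space X, @second_countable X &
    exists p : nat, forall x : X,
    exists (U : opens X) (V : opens 'rV[C]_p)
        (phi : X -> 'rV[C]_p) (psi : 'rV[C]_p -> X),
      [/\ oset U x,
        (forall y, oset U y -> oset V (phi y) /\ psi (phi y) = y),
        (forall z, oset V z -> oset U (psi z) /\ phi (psi z) = z),
        (forall y, oset U y -> {for y, continuous phi}) /\
        (forall z, oset V z -> {for z, continuous psi}) &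
        forall y f, oset U y -> hol A y f <-> holomorphic_at (phi y) (f \o psi)]].

Definition local_ring (S : pzRingType) :=
  let unit (s : S) := exists t, t * s = 1 /\ s * t = 1 in
  (1 : S) <> 0 /\ forall s, unit s \/ unit (1 - s).

(* S is a Z/2-graded C-algebra, the homogeneous parts being [par false] and
   [par true], and it is commutative in the graded sense. *)
Definition supercommutative (S : pzRingType) (scal : {rmorphism C -> S})
    (par : bool -> set S) :=
  [/\ (forall p, par p 0) /\
        (forall p c s t, par p s -> par p t -> par p (scal c * s + t)),
      par false 1 /\
        (forall p q s t, par p s -> par q t -> par (p (+) q) (s * t)),
      (forall s, exists s0 s1, [/\ par false s0, par true s1 & s = s0 + s1]),
      (forall s, par false s -> par true s -> s = 0) &
      (forall p q s t, par p s -> par q t ->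
        s * t = (-1) ^+ (p && q) * (t * s))].

Definition super_iso (X Y : topologicalType) (F : superpresheaf C X)
    (G : superpresheaf C Y) (U : opens X) (V : opens Y)
    (phi : {rmorphism F U -> G V}) :=
  [/\ bijective phi,
      forall c, phi (pscal F U c) = pscal G V c &
      forall p s, ppar p s <-> ppar p (phi s)].

(* F and G are isomorphic over U, the identity being the map of spaces. *)
Definition isomorphic_on (X : topologicalType) (F G : superpresheaf C X)
    (U : opens X) :=
  exists phi : forall V : opens X, V `<=` U -> {rmorphism F V -> G V},
    (forall (V : opens X) (h : V `<=` U), super_iso (phi V h)) /\
    forall (V W : opens X) (h : V `<=` U) (k : W `<=` V) (l : W `<=` U) s,
      phi W l (pres k s) = pres k (phi V h s).

(* An analytic superspace (A is its reduced structure sheaf and E its odd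
   cotangent sheaf) whose reduced space is a complex manifold. *)
Definition supermanifold (S : superspace C) :=
  let F := ssheaf S in
  [/\ is_sheaf (fun U V h => pres h : F U -> F V),
      (forall U, supercommutative (pscal F U) (@ppar _ _ F U)),
      (forall x : S, local_ring (stalk F x)) &
      exists A : function_sheaf C S, complex_manifold A /\
        exists E : omodule A, locally_free E /\
          forall x : S, exists U : opens S, oset U x /\
            isomorphic_on F (sheafify (ext_presheaf E)) U].

(* A homeomorphism f together with an isomorphism from the structure sheaf of
   T to the direct image of that of S. *)
Definition superspace_iso (S T : superspace C) :=
  exists (f : S -> T) (g : T -> S) (fc : continuous f),
    [/\ continuous g, cancel f g, cancel g f &
    exists phi : forall V : opens T,
        {rmorphism ssheaf T V -> ssheaf S (opreim fc V)},
      (forall V, super_iso (phi V)) /\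
      forall (V W : opens T) (h : W `<=` V)
          (k : opreim fc W `<=` opreim fc V) s,
        phi W (pres h s) = pres k (phi V s)].

Definition isomorphic_supermanifolds (S T : superspace C) :=
  [/\ supermanifold S, supermanifold T & superspace_iso S T].
End Supermanifolds.

(* Main.v *)
(* The reduced space and the map of spaces are the identity.  A section of the
   projective superspace over U is a sum of g_I(x) theta_I with g_I homogeneous
   of degree - sum_(a in I) b_a on the cone over U, so a family of sections s_j
   of O(-b_j) defines the odd section sum_j s_j theta_j.  Its square vanishes,
   hence it extends to a morphism from the exterior algebra of the presheaf sum
   of the O(-b_j).  Where x_i <> 0 the module is free on the x_i^(-b_j), and the
   monomials in this frame go to units times the theta_I, so the morphism is
   bijective there; as its target is a sheaf, it induces an isomorphism on the
   sheafification.  All the properties of a supermanifold are checked on the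
   projective side and transported. *)
From HB Require Import structures.
From mathcomp Require Import all_boot all_order all_algebra.
From mathcomp Require Import complex.
From mathcomp Require Import all_classical all_reals all_analysis.
From mathcomp Require Import ring zify.
(* Last, because mathcomp also has constants named incl, proj and invariant. *)
Require Import Defs.

Set Implicit Arguments.
Unset Strict Implicit.
Unset Printing Implicit Defensive.

Import Order.TTheory GRing.Theory Num.Theory.
Import numFieldNormedType.Exports.
Local Open Scope ring_scope.
Local Open Scope classical_set_scope.
Local Open Scope quotient_scope.

(** * Gluing and sheafification *)

(** Sections of the split side are families of germs of quotient terms, with no normal form and no
    usable coefficients, so nothing is proved on them directly: sheaf property, parity and
    invertibility are all read off Grassmann coefficients on the cone. The map splits globally
    because the torus acts on each odd coordinate by a character, without mixing; the weight b_j of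
    theta_j forces its coefficient to have degree -b_j, hence the twist. Linear independence of the
    monomials in the exterior algebra is not established beforehand. Anticommutation only shows that
    they span; their images in the Grassmann algebra are independent, and this gives injectivity.
    The argument works over any [numClosedFieldType] except for one point: a complex manifold must
    be second countable, and for projective space this comes from a countable dense subset and the
    Archimedean property of the complex numbers. *)

Section Regular.
Variables (C : numClosedFieldType) (X : topologicalType).
Variable A : function_sheaf C X.

Lemma opens_near (U : opens X) x : oset U x -> \forall y \near x, oset U y.
Proof. by move=> Ux; apply: open_nbhs_nbhs; split=> //; exact: osetP. Qed.

Lemma regular_glue (U : opens X) (g : U -> C) :
  (forall x : U, exists (V : opens X) (h : V `<=` U),
    oset V (val x) /\ (fun y : V => g (incl h y)) \in regular A V) ->
  g \in regular A U.
Proof.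
(* The default 0 outside U is harmless: [hol] is tested only at points of U and sees only germs. *)
move=> loc; apply/asboolP; pose G y := odflt 0 (omap g (insub y)).
have GE (x : U) : G (val x) = g x by rewrite /G valK.
exists G => [x Ux|x]; last by rewrite GE.
have [V [h [/= Vx /asboolP[F hF gF]]]] := loc (exist _ x (mem_set Ux)).
apply: (hol_near (f := F)); last exact: hF.
have : \forall y \near x, oset V y by exact: opens_near.
apply: filterS => y Vy; have := gF (exist _ y (mem_set Vy)).
by rewrite /= => <-; rewrite -GE.
Qed.

Lemma regfun_eq_at (U V W : opens X) (h : W `<=` U) (k : W `<=` V)
    (f : regfun A U) (g : regfun A V) (x : U) (y : V) :
  rres h f = rres k g -> val x = val y -> oset W (val x) -> f x = g y.
Proof.
move=> e xy Wx; pose z : W := exist _ (val x) (mem_set Wx).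
have /= := congr1 (fun r : regfun A W => r z) e.
have -> : incl h z = x by exact: val_inj.
by have -> : incl k z = y by exact: val_inj.
Qed.

Lemma regfun_sheaf : is_sheaf (@rres C X A).
Proof.
move=> U I W WU cov s compat.
have indep i j (x : W i) (y : W j) : val x = val y -> s i x = s j y.
  move=> xy; have hi : opensI (W i) (W j) `<=` W i by move=> z [].
  have hj : opensI (W i) (W j) `<=` W j by move=> z [].
  apply: (regfun_eq_at (compat i j _ hi hj)) => //.
  split; first exact: set_mem (valP x).
  by rewrite xy; exact: set_mem (valP y).
have cov' (x : U) : {i | oset (W i) (val x)}.
  by apply: cid; have [i _ Wi] := cov _ (set_mem (valP x)); exists i.
pose t (x : U) : C := let: exist i Wi := cov' x in
  s i (exist _ (val x) (mem_set Wi)).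
have tE i (x : W i) : t (incl (WU i) x) = s i x.
    by rewrite /t; case: (cov' _) => j Wj; exact: indep.
have tr : t \in regular A U.
  apply: regular_glue => x; have [i Wi] := cov' x.
  exists (W i), (WU i); split=> //.
  rewrite (_ : (fun _ => _) = rfun (s i)); first exact: rfunP.
  by apply/funext => y; rewrite tE.
exists (Regfun tr); split=> [i|t' ht']; first by apply: regfunP => x /=; rewrite tE.
apply: regfunP => x /=; rewrite /t; case: (cov' _) => i Wi.
by rewrite -ht' /=; congr (rfun t' _); exact: val_inj.
Qed.

End Regular.

Lemma rmorphism_inverse (R S : pzRingType) (f : {rmorphism R -> S}) :
  bijective f -> exists g : {rmorphism S -> R}, cancel f g /\ cancel g f.
Proof.
case=> g fg gf.
pose gz := GRing.isZmodMorphism.Build S R g (can2_zmod_morphism fg gf).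
pose gm := GRing.isMonoidMorphism.Build S R g (can2_monoid_morphism fg gf).
pose g' : {rmorphism S -> R} := HB.pack g gz gm.
by exists g'.
Qed.

Lemma germs_at (C : numClosedFieldType) (X : topologicalType)
    (F : superpresheaf C X) (U : opens X) (s : germs F U) (x : U)
    (q : val x \in oset U) :
  s x = s (exist _ (val x) q).
Proof. by case: x q => y p q; exact: germs_irr. Qed.

(** * Sheafification against a locally bijective map into a sheaf *)

Section Comparison.
Variables (C : numClosedFieldType) (X : topologicalType).
Variables (F G : superpresheaf C X) (theta : forall U, {rmorphism F U -> G U}).
Hypothesis theta_res : forall (U V : opens X) (h : V `<=` U) s,
  theta V (pres h s) = pres h (theta U s).
Hypothesis theta_scal : forall U c, theta U (pscal F U c) = pscal G U c.
Hypothesis theta_par : forall U p s, ppar p s -> ppar p (theta U s).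
Hypothesis G_sheaf : is_sheaf (fun U V h => pres h : G U -> G V).
Hypothesis G_par : forall (U : opens X) p (t : G U),
  (forall x, oset U x -> exists (V : opens X) (h : V `<=` U),
    oset V x /\ ppar p (pres h t)) -> ppar p t.
Hypothesis theta_local : forall x, exists2 U : opens X, oset U x &
  forall W : opens X, W `<=` U -> bijective (theta W) /\
    forall p s, ppar p (theta W s) -> ppar p s.

(* The graph of the isomorphism from the sheafification of F to G. *)
Definition corresponds (U : opens X) (s : sheafify F U) (t : G U) :=
  forall x : U, exists (V : opens X) (h : V `<=` U) (a : F V),
    [/\ oset V (val x),
      forall y (Vy : oset V y),
        shval s (incl h (exist _ y (mem_set Vy))) = germ Vy a &
      theta V a = pres h t].

Lemma corresponds_shrink (U V : opens X) (h : V `<=` U) (s : sheafify F U)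
    (t : G U) (a : F V) (W : opens X) (k : W `<=` V) (l : W `<=` U) :
  (forall y (Vy : oset V y),
     shval s (incl h (exist _ y (mem_set Vy))) = germ Vy a) ->
  theta V a = pres h t ->
  (forall y (Wy : oset W y),
     shval s (incl l (exist _ y (mem_set Wy))) = germ Wy (pres k a)) /\
  theta W (pres k a) = pres l t.
Proof.
move=> sa at_; split=> [y Wy|]; last by rewrite theta_res at_ (pres_comp h k l).
by rewrite (germ_res k (k _ Wy)) -sa; exact: germs_irr.
Qed.

Lemma corresponds2 (U : opens X) (s s' : sheafify F U) (t t' : G U) (x : U) :
  corresponds s t -> corresponds s' t' ->
  exists (V : opens X) (h : V `<=` U) (a a' : F V),
    [/\ oset V (val x),
      forall y (Vy : oset V y),
        shval s (incl h (exist _ y (mem_set Vy))) = germ Vy a,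
      forall y (Vy : oset V y),
        shval s' (incl h (exist _ y (mem_set Vy))) = germ Vy a',
      theta V a = pres h t & theta V a' = pres h t'].
Proof.
move=> /(_ x)[V [h [a [Vx sa ta]]]] /(_ x)[V' [h' [a' [Vx' sa' ta']]]].
pose W := opensI V V'.
have k : W `<=` V by move=> y [].
have k' : W `<=` V' by move=> y [].
have l := subset_trans k h.
have [sb tb] := corresponds_shrink k l sa ta.
have [sb' tb'] := corresponds_shrink k' l sa' ta'.
by exists W, l, (pres k a), (pres k' a').
Qed.

Lemma sheaf_eq (U : opens X) (t t' : G U) :
  (forall x, oset U x -> exists (V : opens X) (h : V `<=` U),
    oset V x /\ pres h t = pres h t') -> t = t'.
Proof.
move=> loc.
(* The inclusion depends on the chosen open set, so the choices at each point are packed in a sigma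
   type and projected afterwards. *)
have D (x : U) : {V : opens X & {h : V `<=` U |
    oset V (val x) /\ pres h t = pres h t'}}.
  have /cid[V /cid[h e]] := loc _ (set_mem (valP x)).
  by exists V, h.
pose V x := projT1 (D x); pose h x : V x `<=` U := projT1 (projT2 (D x)).
have [Vx e] : (forall x, oset (V x) (val x)) /\
    forall x, pres (h x) t = pres (h x) t'.
  by split=> x; have [] := projT2 (projT2 (D x)).
have [||u [_ uniq]] := G_sheaf h _ (s := fun x => pres (h x) t).
- by move=> x Ux; exists (exist _ x (mem_set Ux)) => //; exact: Vx.
- by move=> i j W hi hj; rewrite (pres_comp _ _ (subset_trans hi (h i))) -(pres_comp (h j) hj).
by rewrite -(uniq t) // -(uniq t') // => x; rewrite e.
Qed.

(** Two representatives of s with the same germ agree on a neighbourhood, hence so do their images,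
    and sections of G are determined locally. *)
Lemma corresponds_fun (U : opens X) (s : sheafify F U) (t t' : G U) :
  corresponds s t -> corresponds s t' -> t = t'.
Proof.
move=> st st'; apply: sheaf_eq => x Ux.
have [V [h [a [a' [/= Vx sa sa' ta ta']]]]] :=
  corresponds2 (exist _ x (mem_set Ux)) st st'.
have /germP[W [k [k' [/= Wx e]]]] : germ Vx a = germ Vx a' by rewrite -sa -sa'.
exists W, (subset_trans k h); split=> //.
rewrite -(pres_comp h k) -ta -theta_res e theta_res ta'.
by rewrite (pres_comp h k' (subset_trans k h)).
Qed.

(** Representatives with the same image agree once restricted to an open set on which [theta] is
    injective. *)
Lemma corresponds_inj (U : opens X) (s s' : sheafify F U) (t : G U) :
  corresponds s t -> corresponds s' t -> s = s'.
Proof.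
move=> st st'; apply: shsecP => x; have Ux := set_mem (valP x).
have [V [h [a [a' [/= Vx sa sa' ta ta']]]]] := corresponds2 x st st'.
have [B Bx /= bij] := theta_local (val x).
pose W := opensI V B; have k : W `<=` V by move=> y [].
have Wx : oset W (val x) by [].
have [|/bij_inj inj _] := bij W; first by move=> y [].
have e : pres k a = pres k a' by apply: inj; rewrite !theta_res ta ta'.
have sx : shval s x = germ Vx a by rewrite -sa; exact: germs_at.
have sx' : shval s' x = germ Vx a' by rewrite -sa'; exact: germs_at.
by rewrite sx sx' -(germ_res k Vx Wx) e germ_res.
Qed.

Lemma corresponds_total (U : opens X) (s : sheafify F U) :
  exists t, corresponds s t.
Proof.
have D (x : U) : {V : opens X & {h : V `<=` U & {a : F V | oset V (val x) /\
    forall y (Vy : oset V y),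
      shval s (incl h (exist _ y (mem_set Vy))) = germ Vy a}}}.
  have /asboolP/(_ x)/cid[V /cid[h /cid[a e]]] := shvalP s.
  by exists V, h, a.
pose V x := projT1 (D x); pose h x : V x `<=` U := projT1 (projT2 (D x)).
pose a x : F (V x) := projT1 (projT2 (projT2 (D x))).
have Vx x : oset (V x) (val x) by case: (projT2 (projT2 (projT2 (D x)))) => Vx _; exact: Vx.
have sa x y (Vy : oset (V x) y) :
    shval s (incl (h x) (exist _ y (mem_set Vy))) = germ Vy (a x).
  by case: (projT2 (projT2 (projT2 (D x)))) => _ e; exact: e.
have [||t [te _]] := G_sheaf h _ (s := fun x => theta (V x) (a x)).
- by move=> x Ux; exists (exist _ x (mem_set Ux)) => //; exact: Vx.
(* On an overlap the representatives share their germs but may differ as sections of the presheaf F,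
   so the images are compared near each point. *)
- move=> i j W hi hj; apply: sheaf_eq => y Wy.
  have /germP[Z [k [l [/= Zy e]]]] : germ (hi y Wy) (a i) = germ (hj y Wy) (a j).
    by rewrite -!sa; exact: germs_irr.
  have ZW : opensI Z W `<=` W by move=> z [].
  have ZZ : opensI Z W `<=` Z by move=> z [].
  exists (opensI Z W), ZW; split=> //.
  rewrite (pres_comp _ _ (subset_trans ZZ k)) (pres_comp _ _ (subset_trans ZZ l)).
  by rewrite -!theta_res -(pres_comp k ZZ) e (pres_comp l ZZ (subset_trans ZZ l)).
exists t => x; exists (V x), (h x), (a x).
by split; [exact: Vx|exact: sa|rewrite te].
Qed.

(** Local preimages of t exist where [theta] is bijective. Injectivity on all smaller open sets
    makes their germs agree, so they form a section of the sheafification. *)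
Lemma corresponds_onto (U : opens X) (t : G U) :
  exists s : sheafify F U, corresponds s t.
Proof.
have D (x : U) : {V : opens X & {h : V `<=` U & {a : F V |
    [/\ oset V (val x), theta V a = pres h t &
     forall W : opens X, W `<=` V -> bijective (theta W)]}}}.
  have /cid2[B Bx bij] := theta_local (val x).
  pose V := opensI U B; exists V.
  have h : V `<=` U by move=> y [].
  have VB : V `<=` B by move=> y [].
  exists h; apply: cid; have [[g _ gK] _] := bij V VB.
  exists (g (pres h t)); split; [|exact: gK|].
    by split=> //; exact: set_mem (valP x).
  by move=> W WV; have [] := bij W (subset_trans WV VB).
pose V x := projT1 (D x); pose h x : V x `<=` U := projT1 (projT2 (D x)).
pose a x : F (V x) := projT1 (projT2 (projT2 (D x))).
have Vx x : oset (V x) (val x) by have [] := projT2 (projT2 (projT2 (D x))).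
have ta x : theta (V x) (a x) = pres (h x) t.
  by have [] := projT2 (projT2 (projT2 (D x))).
have bij x (W : opens X) : W `<=` V x -> bijective (theta W).
  by have [_ _ ] := projT2 (projT2 (projT2 (D x))); exact.
have same x z y (p : oset (V x) y) (q : oset (V z) y) :
    germ p (a x) = germ q (a z).
  pose W := opensI (V x) (V z).
  have k : W `<=` V x by move=> ? [].
  have l : W `<=` V z by move=> ? [].
  apply/germP; exists W, k, l; split=> //=.
  apply: (bij_inj (bij x W k)); rewrite !theta_res !ta.
  by rewrite (pres_comp _ k (subset_trans k (h x))) -(pres_comp _ l).
pose s : germs F U := fun x => germ (Vx x) (a x).
have sr : s \in @locally_represented C X F U.
  by apply/asboolP => x; exists (V x), (h x), (a x); split=> // y Vy; exact: same.
exists (ShSec sr) => x; exists (V x), (h x), (a x).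
by split; [exact: Vx|move=> y Vy; exact: same|exact: ta].
Qed.

Definition glued_map (U : opens X) (s : sheafify F U) : G U :=
  projT1 (cid (corresponds_total s)).

Lemma glued_mapP (U : opens X) (s : sheafify F U) (t : G U) :
  corresponds s t <-> glued_map s = t.
Proof.
have st := projT2 (cid (corresponds_total s)).
by split=> [|<-//]; exact: corresponds_fun.
Qed.

Lemma glued_map_zmod (U : opens X) : zmod_morphism (@glued_map U).
Proof.
move=> s s'; apply/glued_mapP => x.
have /glued_mapP st := erefl (glued_map s).
have /glued_mapP st' := erefl (glued_map s').
have [V [h [a [a' [Vx sa sa' ta ta']]]]] := corresponds2 x st st'.
exists V, h, (a - a'); split=> //; last by rewrite !rmorphB ta ta'.
move=> y Vy; rewrite rmorphB.
exact: (congr2 (fun u v => u - v) (sa y Vy) (sa' y Vy)).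
Qed.

Lemma glued_map_monoid (U : opens X) : monoid_morphism (@glued_map U).
Proof.
split=> [|s s']; apply/glued_mapP => x.
  exists U, (@subset_refl _ _), 1; split; [exact: set_mem (valP x)| |].
    by move=> y Vy; rewrite rmorph1.
  by rewrite !rmorph1.
have /glued_mapP st := erefl (glued_map s).
have /glued_mapP st' := erefl (glued_map s').
have [V [h [a [a' [Vx sa sa' ta ta']]]]] := corresponds2 x st st'.
exists V, h, (a * a'); split=> //; last by rewrite !rmorphM ta ta'.
move=> y Vy; rewrite rmorphM.
exact: (congr2 (fun u v => u * v) (sa y Vy) (sa' y Vy)).
Qed.

HB.instance Definition _ (U : opens X) := GRing.isZmodMorphism.Build
  (sheafify F U) (G U) (@glued_map U) (@glued_map_zmod U).
HB.instance Definition _ (U : opens X) := GRing.isMonoidMorphism.Build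
  (sheafify F U) (G U) (@glued_map U) (@glued_map_monoid U).

Lemma glued_map_res (U V : opens X) (h : V `<=` U) (s : sheafify F U) :
  glued_map (pres h s) = pres h (glued_map s).
Proof.
apply/glued_mapP => x; have /glued_mapP st := erefl (glued_map s).
have [W [k [a [Wx sa ta]]]] := st (incl h x).
pose Z := opensI W V.
have ZW : Z `<=` W by move=> y [].
have ZV : Z `<=` V by move=> y [].
have [sb tb] := corresponds_shrink ZW (subset_trans ZV h) sa ta.
exists Z, ZV, (pres ZW a); split.
- by split=> //; exact: set_mem (valP x).
- by move=> y Zy; rewrite -sb; exact: (@germs_irr C X F U (shval s) y).
- by rewrite tb (pres_comp h ZV (subset_trans ZV h)).
Qed.

Lemma glued_map_iso (U : opens X) :
  super_iso (F := sheafify F) (G := G) (@glued_map U : {rmorphism _ -> _}).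
Proof.
split.
- pose g (t : G U) := projT1 (cid (corresponds_onto t)).
  have gP t : corresponds (g t) t by exact: projT2 (cid (corresponds_onto t)).
  exists g => [s|t]; last by apply/glued_mapP; exact: gP.
  by apply: corresponds_inj (gP _) _; apply/glued_mapP.
- move=> c; apply/glued_mapP => x.
  exists U, (@subset_refl _ _), (pscal F U c); split; first exact: set_mem (valP x).
    by move=> y Vy /=; exact: germ_irr.
  by rewrite theta_scal pres_id.
- move=> p s; have /glued_mapP st := erefl (glued_map s).
  split=> ps.
    apply: G_par => x Ux; have [V [h [a [/= Vx sa ta]]]] := st (exist _ x (mem_set Ux)).
    have [W [Wx [c [pc ec]]]] := ps (exist _ x (mem_set Ux)).
    (* The homogeneous representative [c] given by the parity of s may differ from the
       representative [a] paired with the image; they coincide near x. *)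
    have /germP[Z [k [l [/= Zx e]]]] : germ Vx a = germ Wx c.
      by rewrite -sa -ec; exact: germs_irr.
    exists Z, (subset_trans k h); split=> //.
    rewrite -(pres_comp h k) -ta -theta_res e theta_res.
    exact/pres_par/theta_par.
  move=> x; have [V [h [a [/= Vx sa ta]]]] := st x.
  have [B Bx bij] := theta_local (val x).
  pose W := opensI V B; have k : W `<=` V by move=> y [].
  have Wx : oset W (val x) by [].
  have [|_ par] := bij W; first by move=> y [].
  exists W, Wx, (pres k a); split.
    by apply: par; rewrite theta_res ta; do 2 apply: pres_par.
  rewrite (germ_res k Vx) -sa; exact: germs_at.
Qed.

End Comparison.

(** * Local rings and transport along isomorphisms *)

Section LocalStalk.
Variables (C : numClosedFieldType) (X : topologicalType).
Variables (F : superpresheaf C X) (x : X).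

(** Invertibility of a germ stated on sections: it passes through an isomorphism of presheaves
    without an induced map on stalks. *)
Definition locally_unit (U : opens X) (s : F U) :=
  exists (V : opens X) (h : V `<=` U) (t : F V),
    [/\ oset V x, t * pres h s = 1 & pres h s * t = 1].

Lemma stalk_local_ring :
  (forall U : opens X, oset U x -> (1 : F U) <> 0) ->
  (forall (U : opens X) (s : F U), oset U x ->
     locally_unit s \/ locally_unit (1 - s)) ->
  local_ring (stalk F x).
Proof.
move=> nz loc; split.
  have -> : 1 = germ (I : oset (opensT X) x) (1 : F _) by rewrite rmorph1.
  have -> : 0 = germ (I : oset (opensT X) x) (0 : F _) by rewrite rmorph0.
  by move=> /germP[W [h [k [/= Wx]]]]; rewrite rmorph1 rmorph0; exact: nz.
have unitP (U : opens X) (Ux : oset U x) (s : F U) : locally_unit s ->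
    exists t, t * germ Ux s = 1 /\ germ Ux s * t = 1.
  move=> [V [h [t [Vx ts st]]]]; exists (germ Vx t).
  by rewrite -(germ_res h Ux Vx) -!rmorphM ts st rmorph1.
elim/germ_ind=> U Ux s; have [us|us] := loc U s Ux.
  by left; exact: unitP.
right; have -> : 1 - germ Ux s = germ Ux (1 - s) by rewrite rmorphB rmorph1.
exact: unitP.
Qed.

Lemma local_ring_stalk :
  local_ring (stalk F x) ->
  (forall U : opens X, oset U x -> (1 : F U) <> 0) /\
  (forall (U : opens X) (s : F U), oset U x ->
     locally_unit s \/ locally_unit (1 - s)).
Proof.
move=> [nz loc]; split=> [U Ux e|U s Ux].
  by apply: nz; rewrite -(rmorph1 (germ Ux)) e rmorph0.
have unitP (a : F U) : (exists t, t * germ Ux a = 1 /\ germ Ux a * t = 1) ->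
    locally_unit a.
  move=> [t]; elim/germ_ind: t => V Vx t.
  pose W := opensI U V.
  have k : W `<=` U by move=> y [].
  have l : W `<=` V by move=> y [].
  have Wx : oset W x by [].
  rewrite -(germ_res k Ux Wx) -(germ_res l Vx Wx) -!rmorphM.
  rewrite -[1](rmorph1 (germ Wx)) => -[].
  (* The left and right identities hold on different neighbourhoods, which are then intersected. *)
  move=> /germP[Z [z1 [z2 [/= Zx e]]]] /germP[Z' [z1' [z2' [/= Zx' e']]]].
  pose Y := opensI Z Z'.
  have YZ : Y `<=` Z by move=> y [].
  have YZ' : Y `<=` Z' by move=> y [].
  have YW := subset_trans YZ z1.
  exists Y, (subset_trans YW k), (pres YW (pres l t)); split=> //.
    rewrite -(pres_comp k YW) -rmorphM -(pres_comp z1 YZ) e.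
    by rewrite !rmorph1.
  rewrite -(pres_comp k YW) -rmorphM -(pres_comp z1' YZ') e'.
  by rewrite !rmorph1.
have [ug|ug] := loc (germ Ux s); [left|right]; apply: unitP => //.
by rewrite rmorphB rmorph1.
Qed.
End LocalStalk.

Section Transfer.
Variables (C : numClosedFieldType) (X : topologicalType).
Variables (F G : superpresheaf C X) (phi : forall U, {rmorphism F U -> G U}).
Hypothesis phi_iso : forall U, super_iso (phi U).
Hypothesis phi_res : forall (U V : opens X) (h : V `<=` U) s,
  phi V (pres h s) = pres h (phi U s).

Let inj U : injective (phi U).
Proof. by have [/bij_inj] := phi_iso U. Qed.

Let onto U (t : G U) : exists s, phi U s = t.
Proof. by have [[g _ gK] _ _] := phi_iso U; exists (g t). Qed.

Lemma super_iso_sheaf :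
  is_sheaf (fun U V h => pres h : G U -> G V) ->
  is_sheaf (fun U V h => pres h : F U -> F V).
Proof.
move=> Gs U I W WU cov s compat.
have [|t [tE uniq]] := Gs U I W WU cov (fun i => phi (W i) (s i)).
  by move=> i j V hi hj; rewrite -!phi_res (compat i j V hi hj).
have [r rE] := onto t; exists r; split=> [i|r' rE'].
  by apply: inj; rewrite phi_res rE tE.
by apply: inj; rewrite rE; apply: uniq => i; rewrite -phi_res rE'.
Qed.

Lemma super_iso_supercommutative U :
  supercommutative (pscal G U) (@ppar _ _ G U) ->
  supercommutative (pscal F U) (@ppar _ _ F U).
Proof.
have [_ sc par] := phi_iso U.
move=> [[p0 plin] [p1 pM] dec triv comm]; split.
- split=> [p|p c s t ps pt]; apply/par; first by rewrite rmorph0.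
  by rewrite rmorphD rmorphM sc; apply: plin; exact/par.
- split=> [|p q s t ps pt]; apply/par; first by rewrite rmorph1.
  by rewrite rmorphM; apply: pM; exact/par.
- move=> s; have [t0 [t1 [pt0 pt1 e]]] := dec (phi U s).
  have [s0 e0] := onto t0; have [s1 e1] := onto t1.
  exists s0, s1; split; [apply/par; by rewrite e0|apply/par; by rewrite e1|].
  by apply: inj; rewrite e rmorphD e0 e1.
- move=> s /par ps /par ps'; apply: inj; rewrite rmorph0; exact: triv.
- move=> p q s t /par ps /par pt; apply: inj.
  by rewrite !rmorphM rmorph_sign; exact: comm.
Qed.

Lemma super_iso_local_ring x :
  local_ring (stalk G x) -> local_ring (stalk F x).
Proof.
move=> /local_ring_stalk[nz loc]; apply: stalk_local_ring => [U Ux e|U s Ux].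
  by apply: (nz U Ux); rewrite -(rmorph1 (phi U)) e rmorph0.
have unitP (a : F U) : locally_unit x (phi U a) -> locally_unit x a.
  move=> [V [h [t [Vx ta at_]]]]; have [r rE] := onto t.
  by exists V, h, r; split=> //; apply: inj;
    rewrite rmorphM rmorph1 phi_res rE.
by have [/unitP|] := loc U (phi U s) Ux; [left|right; apply: unitP;
  rewrite rmorphB rmorph1].
Qed.

Lemma super_iso_isomorphic_on U : isomorphic_on F G U.
Proof.
exists (fun V _ => phi V); split=> // V W h k l s; exact: phi_res.
Qed.

Lemma super_iso_sym : exists psi : forall U, {rmorphism G U -> F U},
  (forall U, super_iso (psi U)) /\
  forall (U V : opens X) (h : V `<=` U) s, psi V (pres h s) = pres h (psi U s).
Proof.
have D U : {g : {rmorphism G U -> F U} | cancel (phi U) g /\ cancel g (phi U)}.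
  by apply: cid; have [bij _ _] := phi_iso U; exact: rmorphism_inverse.
pose psi U := projT1 (D U).
have [psiK phiK] : (forall U, cancel (phi U) (psi U)) /\
    forall U, cancel (psi U) (phi U).
  by split=> U; have [] := projT2 (D U).
exists psi; split=> [U|U V h s].
  have [_ sc par] := phi_iso U; split; first by exists (phi U).
    by move=> c; rewrite -sc psiK.
  by move=> p s; rewrite -{1}[s]phiK; apply: iff_sym; exact: par.
by apply: inj; rewrite phi_res !phiK.
Qed.
End Transfer.

Lemma isomorphic_on_refl (C : numClosedFieldType) (X : topologicalType)
  (F : superpresheaf C X) U : isomorphic_on F F U.
Proof.
by exists (fun V _ => (idfun : {rmorphism F V -> F V})).
Qed.

(** * Grassmann algebras *)

Section GrassmannTheory.
Variables (n : nat) (A : comPzRingType).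
Local Notation G := (grassmann n A).
Local Notation idx := {set 'I_n}.

Lemma gmulE (f g : G) K : (f * g) K =
  \sum_(I : idx | I \subset K) (-1) ^+ inversions I (K :\: I) * (f I * g (K :\: I)).
Proof. by rewrite ffunE. Qed.

Lemma gscal_mulE a (f : G) K : (gscal n a * f) K = a * f K.
Proof.
rewrite gmulE (bigD1 finset.set0) ?finset.sub0set //= big1 => [|I /andP[_ /negbTE I0]].
  by rewrite ffunE eqxx inversions0l finset.setD0 mul1r addr0.
by rewrite ffunE I0 mul0r mulr0.
Qed.

Lemma gscalC a (f : G) : gscal n a * f = f * gscal n a.
Proof.
apply/ffunP => K; rewrite gscal_mulE gmulE (bigD1 K) //= big1 => [|I /andP[IK nIK]].
  by rewrite ffunE finset.setDv eqxx inversions0r mul1r addr0 mulrC.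
have /negbTE KI : ~~ (K \subset I) by apply: contra nIK => KI; rewrite finset.eqEsubset IK.
by rewrite ffunE finset.setD_eq0 KI !mulr0.
Qed.

(** Each pair in I x J has distinct entries, so it is an inversion in exactly one of the two
    orders. *)
Lemma inversions_disjoint (I J : idx) : (forall i, i \in I -> i \notin J) ->
  (inversions I J + inversions J I = #|I| * #|J|)%N.
Proof.
move=> dIJ; rewrite {2}/inversions exchange_big /inversions -big_split /=.
rewrite -sum_nat_const; apply: eq_bigr => i iI.
rewrite -big_split /= -sum1_card; apply: eq_bigr => j jJ.
have : i != j :> nat.
  by apply: contraTneq jJ => /val_inj <-; exact: dIJ.
by case: ltngtP.
Qed.

(** Replacing I by its complement in K exchanges the two factors; by [inversions_disjoint] the two
    signs differ by the parity of the product of the cardinals, which is p && q on nonzero terms. *)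
Lemma grassmann_supercommutative (p q : bool) (f g : G) :
  ghomog p f -> ghomog q g -> f * g = (-1) ^+ (p && q) * (g * f).
Proof.
move=> hf hg; rewrite -(rmorph_sign (@gscal n A)); apply/ffunP => K.
rewrite gscal_mulE !gmulE mulr_sumr.
rewrite (reindex_onto (fun I : idx => K :\: I) (fun I : idx => K :\: I)) /=; last first.
  by move=> I IK; rewrite finset.setDDr finset.setDv finset.set0U; exact/finset.setIidPr.
have E (I : idx) : (K :\: I \subset K) && (K :\: (K :\: I) == I) = (I \subset K).
  rewrite finset.setDDr finset.setDv finset.set0U finset.subsetDl /=.
  by apply/eqP/idP => /finset.setIidPr.
rewrite (eq_bigl _ _ E); apply: eq_bigr => I IK.
have -> : K :\: (K :\: I) = I.
  by rewrite finset.setDDr finset.setDv finset.set0U; exact/finset.setIidPr.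
have [oI|oI] := eqVneq (odd #|I|) q; last by rewrite hg // !(mul0r, mulr0).
have [oJ|oJ] := eqVneq (odd #|K :\: I|) p; last by rewrite hf // !(mul0r, mulr0).
rewrite [RHS]mulrA [f _ * _]mulrC; congr (_ * _).
rewrite -signr_odd -[X in _ = _ * X]signr_odd -signr_addb; congr (_ ^+ _).
have := inversions_disjoint (I := I) (J := K :\: I).
move=> /(_ _)/(congr1 odd); rewrite oddD oddM oI oJ andbC => <-.
  by rewrite addbAC addbb.
by move=> i iI; rewrite inE iI.
Qed.

Lemma grassmann_nilpotent (f : G) : f finset.set0 = 0 -> f ^+ n.+1 = 0.
Proof.
(* Each factor without constant term raises the degree by at least 1, and no subset has more than n
   elements, whence the exponent n.+1. *)
move=> f0; have low k (K : idx) : (#|K| < k)%N -> (f ^+ k) K = 0.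
  elim: k K => // k IH K Kk; rewrite exprS gmulE big1 // => I IK.
  have [->|I0] := eqVneq I finset.set0; first by rewrite f0 mul0r mulr0.
  rewrite IH ?mulr0 // cardsDS //.
  move: I0 (subset_leq_card IK) Kk; rewrite -finset.card_gt0; lia.
apply/ffunP => K; rewrite low ?ffunE // ltnS.
by rewrite -[leqRHS]card_ord max_card.
Qed.

Definition glin (c : 'I_n -> A) : G :=
  [ffun K : idx => \sum_j (if K == [set j]%SET then c j else 0)].

Lemma glin1 c j : glin c [set j]%SET = c j.
Proof.
rewrite ffunE (bigD1 j) //= eqxx big1 ?addr0 // => k kj.
by rewrite (inj_eq (@finset.set1_inj _)) eq_sym (negbTE kj).
Qed.

Lemma glin_card c (K : idx) : #|K| != 1%N -> glin c K = 0.
Proof.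
move=> K1; rewrite ffunE big1 // => j _; case: (K =P _) K1 => [->|//].
by rewrite cards1.
Qed.

Lemma glin_homog c : ghomog true (glin c).
Proof. by move=> K oK; apply: glin_card; apply: contra oK => /eqP ->. Qed.

Lemma glinD c d : glin (fun j => c j + d j) = glin c + glin d.
Proof.
apply/ffunP => K; rewrite !ffunE -big_split; apply: eq_bigr => j _.
by case: eqP => // _; rewrite -[RHS]/(0 + 0) addr0.
Qed.

Lemma glinZ a c : glin (fun j => a * c j) = gscal n a * glin c.
Proof.
apply/ffunP => K; rewrite gscal_mulE !ffunE mulr_sumr; apply: eq_bigr => j _.
by case: eqP => //; rewrite mulr0.
Qed.

(* Supercommutativity only gives twice the claim, whence the hypothesis on A. *)
Lemma glin_alt c : (forall a : A, a *+ 2 = 0 -> a = 0) -> glin c * glin c = 0.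
Proof.
move=> two; have e := grassmann_supercommutative (glin_homog c) (glin_homog c).
apply/ffunP => K; rewrite [RHS]ffunE; apply: two; rewrite mulr2n {1}e.
by rewrite expr1 mulN1r ffunE addNr.
Qed.
End GrassmannTheory.

(** The inverse is the finite geometric series; S is noncommutative, so both sides are checked. *)
Lemma one_sub_nilpotent (S : pzRingType) (x : S) k : x ^+ k = 0 ->
  exists t, t * (1 - x) = 1 /\ (1 - x) * t = 1.
Proof.
move=> xk; exists (\sum_(i < k) x ^+ i).
have e : (1 - x) * (\sum_(i < k) x ^+ i) = 1.
  by rewrite -opprB mulNr -subrX1 xk sub0r opprK.
split=> //; rewrite -[RHS]e; apply: commr_sym; apply: commr_sum => i _.
by apply: commr_sym; apply: commrB; [exact: commr1|apply: commr_sym; exact: commrX].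
Qed.

(** * Words in anticommuting elements of square zero *)

Section Words.
Variables (n : nat) (A : comPzRingType) (S : pzRingType) (sc : {rmorphism A -> S}).
Variable e : 'I_n -> S.
Hypothesis sc_central : forall a x, sc a * x = x * sc a.
Hypothesis e_alt : forall j, e j * e j = 0.
Hypothesis e_anti : forall j k, e j * e k = - (e k * e j).
Local Notation idx := {set 'I_n}.
Local Notation lt := (fun i j : 'I_n => (i < j)%N).

Definition word (s : seq 'I_n) : S := \prod_(j <- s) e j.

Lemma enum_set_sorted (I : idx) : sorted lt (enum I).
Proof.
have e_ : sorted lt (enum 'I_n).
  by have := iota_ltn_sorted 0 n; rewrite -val_enum_ord sorted_map.
rewrite enumT in e_; apply: sorted_filter e_ => ? ? ?; exact: ltn_trans.
Qed.

Lemma enum_sorted (s : seq 'I_n) : sorted lt s -> enum [set j in s]%SET = s.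
Proof.
move=> ss; apply: (irr_sorted_eq (leT := lt)) => //.
- by move=> ? ? ?; exact: ltn_trans.
- by move=> ?; exact: ltnn.
- exact: enum_set_sorted.
- by move=> j; rewrite mem_enum inE.
Qed.

(* The integer k is 1, -1 or 0. *)
Lemma word_insert j s : sorted lt s -> exists (t : seq 'I_n) (k : int),
  [/\ sorted lt t, {subset t <= j :: s} & e j * word s = word t *~ k].
Proof.
have tr : transitive lt by move=> ? ? ?; exact: ltn_trans.
elim: s => [_|k s IH ks].
  by exists [:: j], 1; split=> //; rewrite /word big_seq1 big_nil mulr1.
have ss : sorted lt s := path_sorted ks.
have [jk|kj|/val_inj jk] := ltngtP j k.
- exists [:: j, k & s], 1; split=> //; last by rewrite /word !big_cons.
  by rewrite /= jk.
(* Moving e j past e k costs a sign. The inclusion of t in j :: s, carried by the induction, shows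
   that k still precedes every letter of t. *)
- have [t [c [st ts et]]] := IH ss; exists (k :: t), (- c).
  have lk : all (lt k) s by move: ks; rewrite /= path_sortedE // => /andP[].
  split=> /=.
  + rewrite path_sortedE // st andbT; apply/allP => i /ts; rewrite inE.
    by move=> /predU1P[-> //|]; exact: (allP lk).
  + move=> i; rewrite !inE => /orP[->|/ts]; first by rewrite orbT.
    by rewrite inE => /orP[->|->]; rewrite ?orbT.
  + rewrite /word !big_cons mulrA e_anti mulNr -mulrA -/(word s) et.
    by rewrite mulrzAr mulrNz.
- exists [::], 0; split=> //; rewrite jk /word big_cons mulrA e_alt mul0r.
  by rewrite mulr0z.
Qed.

Definition spanned (x : S) :=
  exists c : idx -> A, x = \sum_I sc (c I) * word (enum I).

Lemma spanned_word a s : sorted lt s -> spanned (sc a * word s).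
Proof.
move=> ss; exists (fun I => if I == [set j in s]%SET then a else 0).
rewrite (bigD1 [set j in s]%SET) //= eqxx enum_sorted // big1 ?addr0 //.
by move=> I /negbTE ->; rewrite rmorph0 mul0r.
Qed.

Lemma spannedD x y : spanned x -> spanned y -> spanned (x + y).
Proof.
move=> [c ->] [d ->]; exists (fun I => c I + d I); rewrite -big_split /=.
by apply: eq_bigr => I _; rewrite rmorphD mulrDl.
Qed.

Lemma spanned_sc a x : spanned x -> spanned (sc a * x).
Proof.
move=> [c ->]; exists (fun I => a * c I); rewrite mulr_sumr.
by apply: eq_bigr => I _; rewrite rmorphM mulrA.
Qed.

Lemma spanned0 : spanned 0.
Proof. by exists (fun=> 0); rewrite big1 // => I _; rewrite rmorph0 mul0r. Qed.

Lemma spanned_e j x : spanned x -> spanned (e j * x).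
Proof.
move=> [c ->]; rewrite mulr_sumr; apply: big_ind => [||I _].
- exact: spanned0.
- exact: spannedD.
have [t [k [st _ et]]] := word_insert j (enum_set_sorted I).
rewrite mulrA -sc_central -mulrA et mulrzAr -mulrzAl -rmorphMz.
exact: spanned_word.
Qed.

Lemma spanned1 : spanned 1.
Proof.
by have := @spanned_word 1 [::] isT; rewrite rmorph1 /word big_nil mulr1.
Qed.
End Words.

Section GrassmannWords.
Variables (n : nat) (A : comPzRingType) (u : 'I_n -> A).
Local Notation idx := {set 'I_n}.
Local Notation lt := (fun i j : 'I_n => (i < j)%N).

Definition gtheta j : grassmann n A := glin (fun k => if k == j then u j else 0).

Lemma gthetaE j (K : idx) : gtheta j K = if K == [set j]%SET then u j else 0.
Proof.
have [->|Kj] := eqVneq; first by rewrite glin1 eqxx.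
rewrite ffunE big1 // => k _; case: eqP => // Kk.
by case: eqP => // kj; rewrite Kk kj eqxx in Kj.
Qed.

(** An increasing word has no inversions, so its sign is +1. The induction multiplies on the left by
    the smallest index j, where only I = {j} contributes. *)
Lemma gtheta_word s : sorted lt s -> forall K : idx,
  word gtheta s K = if K == [set j in s]%SET then \prod_(j in K) u j else 0.
Proof.
have tr : transitive lt by move=> ? ? ?; exact: ltn_trans.
elim: s => [_|j s IH js] K.
  rewrite /word big_nil ffunE.
  have -> : [set j in [::]]%SET = finset.set0 :> idx by apply/setP => k; rewrite !inE.
  by case: eqP => // ->; rewrite finset.big_set0.
have ls : all (lt j) s by move: js; rewrite /= path_sortedE // => /andP[].
have jNs : j \notin s by apply/negP => /(allP ls); rewrite ltnn.
rewrite /word big_cons -/(word gtheta s) gmulE.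
have [jK|jK] := boolP (j \in K); last first.
  rewrite big1 => [|I IK].
    by case: eqP => // KE; rewrite KE !inE eqxx in jK.
  rewrite gthetaE; case: eqP IK => [->|_ _]; last by rewrite mul0r mulr0.
  by rewrite finset.sub1set (negbTE jK).
rewrite (bigD1 [set j]%SET) ?finset.sub1set //= big1 ?addr0; last first.
  by move=> I /andP[_ /negbTE I1]; rewrite gthetaE I1 mul0r mulr0.
rewrite gthetaE eqxx IH; last exact: path_sorted js.
have -> : (K :\: [set j] == [set k in s])%SET = (K == [set k in j :: s]%SET).
  apply/eqP/eqP => [/setP E|->]; apply/setP => k; rewrite ?inE; last first.
    by have [->|] := eqVneq k j; rewrite /= ?(negbTE jNs).
  have := E k; rewrite !inE; have [->|] := eqVneq k j; rewrite //= jK.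
case: eqP => [KE|_]; last by rewrite !mulr0.
have -> : inversions [set j]%SET (K :\: [set j]%SET) = 0%N.
  rewrite /inversions finset.big_set1 big1 // => k; rewrite KE !inE.
  move=> /andP[/negbTE kj]; rewrite kj /= => /(allP ls) jk.
  by rewrite ltnNge ltnW.
by rewrite mul1r [RHS](finset.big_setD1 j).
Qed.
End GrassmannWords.

(** * Projective space *)

Lemma differentiable_rV (K : numFieldType) (V : normedModType K) (p : nat)
    (f : V -> 'rV[K]_p) (x : V) :
  (forall j, differentiable (fun y => f y ord0 j : K) x) -> differentiable f x.
Proof.
move=> df.
have -> : f = \sum_(j < p) (fun y => f y ord0 j *: delta_mx ord0 j).
  apply/funext => y; rewrite fct_sumE [LHS]matrix_sum_delta big_ord1.
  by [].
by apply: differentiable_sum => j; exact: differentiableZl.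
Qed.

Lemma sub_nbhsP (T : topologicalType) (Y : set T) (v : Y) (A : set Y) :
  nbhs v A <-> exists2 B : set T, nbhs (val v) B & val @^-1` B `<=` A.
Proof.
split=> [nA|[B nB BA]].
  rewrite nbhsE in nA; case: nA => S [[B oB <-] Bv] SA.
  by exists B => //; apply: open_nbhs_nbhs.
apply: (filterS BA).
by apply: (@initial_continuous _ _ (set_val : Y -> T) v).
Qed.

Lemma nbhs_neq0 (K : numFieldType) (x : K) :
  x != 0 -> nbhs x [set y | y != 0].
Proof.
move=> x0; apply/nbhs_ballP; exists `|x|; first by rewrite /= normr_gt0.
move=> y /=; rewrite -ball_normE /= => xy; apply: contraTneq xy => ->.
by rewrite subr0 ltxx.
Qed.

Section Projection.
Variables (C : numClosedFieldType) (m : nat).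
Local Notation P := (projective_space C m).
Local Notation V := (punctured C m).
Local Notation proj := (@proj C m).

Lemma proj_surj q : exists v, proj v = q.
Proof.
by exists (repr q); exact: reprK.
Qed.

Lemma dilation_subproof (l : C) (l0 : l != 0) (v : V) :
  l *: val v \in [set x : 'rV[C]_m.+1 | x != 0].
Proof. by apply/mem_set; rewrite /= scaler_eq0 negb_or l0; exact: set_mem (valP v). Qed.

Definition dilation (l : C) (l0 : l != 0) (v : V) : V :=
  exist _ (l *: val v) (dilation_subproof l0 v).

Lemma proj_dilation (l : C) (l0 : l != 0) v : proj (dilation l0 v) = proj v.
Proof. by apply/esym/projP; exists l. Qed.

(** The saturation of O is open: a vector on the line of some w in O is carried to w by a dilation,
    which carries nearby vectors into O by continuity. *)
Lemma proj_open (O : set V) : open O -> open (proj @` O).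
Proof.
move=> oO; rewrite -[open _]/(open (proj @^-1` (proj @` O))) openE => v [w Ow].
move=> /esym/projP[l l0 wv].
have /sub_nbhsP[B nB BO] : nbhs w O by exact: open_nbhs_nbhs.
apply/sub_nbhsP; exists ([set x | B (l *: x)]).
  have /(_ B) := @scaler_continuous _ 'rV[C]_m.+1 l (val v).
  by rewrite -wv; exact.
move=> v' Bv'; exists (dilation l0 v'); last exact: proj_dilation.
exact: BO.
Qed.

(** Since [proj] is open, local questions on P are decided at any single vector over the point. *)
Lemma proj_nbhs v (A : set P) : nbhs (proj v) A <-> nbhs v (proj @^-1` A).
Proof.
split=> [|nA]; first exact: proj_continuous.
rewrite nbhsE in nA; case: nA => [S [oS Sv] SA]; apply: (filterS (P := proj @` S)).
  by move=> _ [w Sw <-]; exact: SA.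
by apply: open_nbhs_nbhs; split; [exact: proj_open|exists v].
Qed.

Lemma proj_nbhs_image v (A : set V) : nbhs v A -> nbhs (proj v) (proj @` A).
Proof. by move=> nA; apply/proj_nbhs; apply: filterS nA => w Aw; exists w. Qed.

Lemma coord_neq0_near (x : 'rV[C]_m.+1) i : x ord0 i != 0 ->
  \forall y \near x, (y : 'rV[C]_m.+1) ord0 i != 0.
Proof.
by move=> /nbhs_neq0; exact: (@coord_continuous C 1 m.+1 ord0 i x).
Qed.

Lemma projective_hausdorff : hausdorff_space P.
Proof.
move=> p q; have [v <-] := proj_surj p; have [w <-] := proj_surj q => clu.
have minor i j : val v ord0 i * val w ord0 j = val v ord0 j * val w ord0 i.
  apply/eqP/negPn/negP => ne.
  (* The 2 x 2 minors vanish exactly on pairs of proportional vectors. *)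
  pose f (xy : 'rV[C]_m.+1 * 'rV[C]_m.+1) : C :=
    xy.1 ord0 i * xy.2 ord0 j - xy.1 ord0 j * xy.2 ord0 i.
  have fc : {for (val v, val w), continuous f}.
    have c1 k : {for (val v, val w), continuous
        (fun xy : 'rV[C]_m.+1 * 'rV[C]_m.+1 => xy.1 ord0 k)}.
      apply: (@continuous_comp _ _ _ fst (fun x : 'rV[C]_m.+1 => x ord0 k)).
        exact: cvg_fst.
      exact: coord_continuous.
    have c2 k : {for (val v, val w), continuous
        (fun xy : 'rV[C]_m.+1 * 'rV[C]_m.+1 => xy.2 ord0 k)}.
      apply: (@continuous_comp _ _ _ snd (fun x : 'rV[C]_m.+1 => x ord0 k)).
        exact: cvg_snd.
      exact: coord_continuous.
    by apply: cvgB; apply: cvgM; [exact: c1|exact: c2|exact: c1|exact: c2].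
  have : nbhs (val v, val w) (f @^-1` [set x | x != 0]).
    by apply: fc; apply: nbhs_neq0; rewrite /f subr_eq0.
  move=> [[A B] [/= nA nB] AB].
  (* The images of A and B are neighbourhoods of two inseparable points, so they meet. This gives
     proportional vectors in A and B, on which the minor vanishes. *)
  have [_ [[a Aa <-] [b Bb]]] := clu _ _
    (proj_nbhs_image (iffRL (sub_nbhsP _ _) (ex_intro2 _ _ A nA (fun _ => id))))
    (proj_nbhs_image (iffRL (sub_nbhsP _ _) (ex_intro2 _ _ B nB (fun _ => id)))).
  move=> /esym/projP[l l0 ba].
  have /negP := AB (val a, val b) (conj Aa Bb); apply.
  by rewrite /f /= ba !mxE; apply/eqP; ring.
have [i vi] : exists i, val v ord0 i != 0.
  by have /rV0Pn := set_mem (valP v).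
have wv : val w = (val w ord0 i / val v ord0 i) *: val v.
  by apply/rowP => j; rewrite mxE mulrAC -[_ * val v _ j]mulrC -minor mulrC mulKf.
apply/projP; exists (val w ord0 i / val v ord0 i) => //.
apply/negP => /eqP e; have : val w != 0 := set_mem (valP w).
by rewrite wv e scale0r eqxx.
Qed.
End Projection.

(** * Standard charts and the manifold structure *)

Section Charts.
Variables (C : numClosedFieldType) (m : nat).
Local Notation P := (projective_space C m).
Local Notation V := (punctured C m).
Local Notation proj := (@proj C m).

Lemma punctured_neq0 (v : V) : exists i, val v ord0 i != 0.
Proof. exact/rV0Pn/(set_mem (valP v)). Qed.

Lemma near_val (v : V) (A : set 'rV[C]_m.+1) :
  nbhs (val v) A -> \forall w \near v, A (val w).
Proof. by move=> nA; apply/sub_nbhsP; exists A. Qed.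

Section Chart.
Variable i : 'I_m.+1.

Lemma standard_subproof : open (proj @` [set v : V | val v ord0 i != 0]).
Proof.
apply: proj_open; rewrite openE => v vi.
apply: (near_val (A := fun x => x ord0 i != 0)); exact: coord_neq0_near.
Qed.

Definition standard_open : opens P := Opens standard_subproof.

Lemma standard_openP v : oset standard_open (proj v) <-> val v ord0 i != 0.
Proof.
split=> [[w wi /esym/projP[l l0 wv]]|vi]; last by exists v.
by move: wi; rewrite /= wv mxE mulf_eq0 negb_or => /andP[].
Qed.

Definition dehomogenize (x : 'rV[C]_m.+1) : 'rV[C]_m :=
  \row_j (x ord0 (lift i j) / x ord0 i).

Definition homogenize (z : 'rV[C]_m) : 'rV[C]_m.+1 :=
  \row_k (if unlift i k is Some j then z ord0 j else 1).

Lemma homogenizeK : cancel homogenize dehomogenize.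
Proof.
by move=> z; apply/rowP => j; rewrite !mxE liftK unlift_none divr1.
Qed.

Lemma dehomogenizeK (x : 'rV[C]_m.+1) : x ord0 i != 0 ->
  homogenize (dehomogenize x) = (x ord0 i)^-1 *: x.
Proof.
move=> xi; apply/rowP => k; rewrite !mxE.
by case: unliftP => [j|] ->; rewrite ?mxE ?mulVf // mulrC.
Qed.

Lemma dehomogenizeZ (l : C) (x : 'rV[C]_m.+1) : l != 0 ->
  dehomogenize (l *: x) = dehomogenize x.
Proof. by move=> l0; apply/rowP => j; rewrite !mxE -mulf_div divff // mul1r. Qed.

Lemma homogenize_i z : homogenize z ord0 i = 1.
Proof. by rewrite mxE unlift_none. Qed.

Lemma homogenize_subproof z : homogenize z \in [set x : 'rV[C]_m.+1 | x != 0].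
Proof.
by apply/mem_set/rV0Pn; exists i; rewrite homogenize_i oner_neq0.
Qed.

(** Total on P: where coordinate i vanishes, the convention on the inverse of 0 gives the value 0.
    Independence of the representative is [dehomogenizeZ]. *)
Definition chart (q : P) : 'rV[C]_m := dehomogenize (val (repr q)).
Definition lift_chart (z : 'rV[C]_m) : V :=
  exist _ (homogenize z : 'rV[C]_m.+1) (homogenize_subproof z).
Definition chart_inv (z : 'rV[C]_m) : P := proj (lift_chart z).

Lemma chart_proj v : chart (proj v) = dehomogenize (val v).
Proof.
have /projP[l l0 e] : proj (repr (proj v)) = proj v by exact: reprK.
by rewrite e dehomogenizeZ.
Qed.

Lemma chartK q : oset standard_open q -> chart_inv (chart q) = q.
Proof.
have [v <-] := proj_surj q => /standard_openP vi; apply/projP.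
exists (val v ord0 i) => //=.
by rewrite chart_proj dehomogenizeK // scalerA mulfV // scale1r.
Qed.

Lemma chart_invK : cancel chart_inv chart.
Proof. by move=> z; rewrite /chart_inv chart_proj homogenizeK. Qed.

Lemma chart_inv_standard z : oset standard_open (chart_inv z).
Proof. by apply/standard_openP; rewrite /= homogenize_i oner_neq0. Qed.

Lemma dehomogenize_differentiable (x : 'rV[C]_m.+1) : x ord0 i != 0 ->
  differentiable dehomogenize x.
Proof.
move=> xi; apply: differentiable_rV => j.
have -> : (fun y : 'rV[C]_m.+1 => dehomogenize y ord0 j : C) =
    (fun y : 'rV[C]_m.+1 => (y ord0 (lift i j) : C)) *
    (fun y : 'rV[C]_m.+1 => (y ord0 i : C)^-1).
  by apply/funext => y; rewrite mxE.
apply: differentiableM; first exact: differentiable_coord.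
by apply: differentiableV => //; exact: differentiable_coord.
Qed.

Lemma homogenize_differentiable z : differentiable homogenize z.
Proof.
apply: differentiable_rV => k.
case: (unliftP i k) => [j ->|->].
  have -> : (fun z => homogenize z ord0 (lift i j) : C) =
      (fun z : 'rV[C]_m => (z ord0 j : C)).
    by apply/funext => y; rewrite mxE liftK.
  exact: differentiable_coord.
have -> : (fun z => homogenize z ord0 i : C) = cst 1.
  by apply/funext => y; rewrite homogenize_i.
exact: differentiable_cst.
Qed.

Lemma lift_chart_continuous : continuous lift_chart.
Proof.
move=> z A /sub_nbhsP[B nB BA].
have nz : nbhs z (homogenize @^-1` B).
  exact: differentiable_continuous (homogenize_differentiable z) _ nB.
change (nbhs z (lift_chart @^-1` A)).
by apply: filterS nz => y By; exact: BA.
Qed.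

Lemma chart_inv_continuous : continuous chart_inv.
Proof.
move=> z; apply: continuous_comp; first exact: lift_chart_continuous.
exact: proj_continuous.
Qed.

Lemma chart_continuous q : oset standard_open q -> {for q, continuous chart}.
Proof.
have [v <-] := proj_surj q => /standard_openP vi A.
rewrite chart_proj => nA; apply/proj_nbhs.
have : nbhs (val v) (dehomogenize @^-1` A).
  exact: differentiable_continuous (dehomogenize_differentiable vi) _ nA.
by move=> /near_val; apply: filterS => w; rewrite /= chart_proj.
Qed.

(** Holomorphy on P is holomorphy of the pullback to punctured space. The section [lift_chart] of
    [proj] brings it down to the chart, and composition with [dehomogenize] brings it back. *)
Lemma chart_hol q (f : P -> C) : oset standard_open q ->
  hol (projective_sheaf C m) q f <-> holomorphic_at (chart q) (f \o chart_inv).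
Proof.
move=> Uq; split=> [hf|hf].
  have : nbhs (chart_inv (chart q)) [set q' | forall v, proj v = q' ->
      hol (punctured_sheaf C m) v (f \o proj)] by rewrite chartK.
  move=> /chart_inv_continuous nz.
  have {}nz : \forall z \near chart q, forall v, proj v = chart_inv z ->
    hol (punctured_sheaf C m) v (f \o proj) by exact: nz.
  apply: filterS nz => z /(_ (lift_chart z) erefl)[F /nbhs_singleton dF fF].
  have fF' : \forall y \near z, f (proj (lift_chart y)) = F (homogenize y).
    exact: lift_chart_continuous fF.
  apply: (@differentiable_near _ _ _ _ (F \o homogenize)).
    by apply: filterS fF' => y /= <-.
  exact: differentiable_comp (homogenize_differentiable z) dF.
have Un : \forall q' \near q, oset standard_open q'.
  by apply: open_nbhs_nbhs; split=> //; exact: osetP.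
have Hn : \forall q' \near q, holomorphic_at (chart q') (f \o chart_inv).
  exact: (chart_continuous Uq (holomorphic_open hf)).
apply: filterS2 Un Hn => q' Uq' /= dF v vq'; subst q'.
have vi : val v ord0 i != 0 by exact/standard_openP.
rewrite chart_proj in dF.
(* The punctured sheaf asks for a function on the whole vector space; this one agrees with f \o
   [proj] where coordinate i is nonzero. *)
exists ((f \o chart_inv) \o dehomogenize).
  have nx : nbhs (val v) (dehomogenize @^-1`
      [set z | differentiable (f \o chart_inv) z]).
    exact: differentiable_continuous (dehomogenize_differentiable vi) _ dF.
  apply: filterS2 (coord_neq0_near vi) nx => x xi dx.
  exact: differentiable_comp (dehomogenize_differentiable xi) dx.
have : \forall w \near v, val (w : V) ord0 i != 0.
  exact: near_val (coord_neq0_near vi).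
apply: filterS => w /standard_openP wi.
by rewrite /= -chart_proj chartK.
Qed.
End Chart.

Lemma standard_open_cover q : exists i, oset (standard_open i) q.
Proof.
have [v <-] := proj_surj q; have [i vi] := punctured_neq0 v.
by exists i; apply/standard_openP.
Qed.

Lemma projective_manifold : @second_countable P ->
  complex_manifold (projective_sheaf C m).
Proof.
move=> sc; split=> //; first exact: projective_hausdorff.
exists m => q; have [i Ui] := standard_open_cover q.
exists (standard_open i), (opensT _), (chart i), (chart_inv i); split=> //.
- by move=> y Uy; split=> //; exact: chartK.
- by move=> z _; split; [exact: chart_inv_standard|exact: chart_invK].
- split=> [y Uy|z _]; first exact: chart_continuous.
  exact: chart_inv_continuous.
- by move=> y f Uy; exact: chart_hol.
Qed.
End Charts.

(** * A countable base *)

Section ComplexTopology.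
Variable R : realType.
Local Open Scope complex_scope.

Definition rational_complex (q : rat * rat) : R[i] := ratr q.1 +i* ratr q.2.

Lemma rational_complex_dense (z e : R[i]) : 0 < e ->
  exists q, `|z - rational_complex q| < e.
Proof.
case: e => e e'; rewrite ltcE /= => /andP[/eqP -> e0].
case: z => x y.
have near_rat (t : R) : exists q : rat, `|t - ratr q| < e / 2.
  have [|q] := @rat_in_itvoo R (t - e / 2) (t + e / 2).
    by rewrite ltrBlDr -addrA -splitr ltrDl.
  by rewrite in_itv /= => /andP[h1 h2]; exists q; rewrite ltr_distlC h1 h2.
have [q1 h1] := near_rat x; have [q2 h2] := near_rat y; exists (q1, q2).
rewrite normc_def ltcR /=.
apply: (@le_lt_trans _ _ (`|x - ratr q1| + `|y - ratr q2|)); last first.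
  by rewrite [ltRHS]splitr ltrD.
rewrite -(ler_pXn2r (n := 2)) ?nnegrE ?sqrtr_ge0 ?addr_ge0 //.
rewrite sqr_sqrtr ?addr_ge0 ?sqr_ge0 // [leRHS]sqrrD !real_normK ?num_real //.
by rewrite addrAC lerDl mulrn_wge0 // mulr_ge0.
Qed.

Lemma complex_archimedean (e : R[i]) : 0 < e -> exists k : nat, k.+1%:R^-1 < e.
Proof.
case: e => e e'; rewrite ltcE /= => /andP[/eqP -> e0].
have [k] := ltr_add_invr e0; rewrite add0r => ke; exists k.
rewrite -[e +i* 0]/(e%:C) -(rmorph_nat (real_complex R)) -fmorphV.
by rewrite ltcR.
Qed.
End ComplexTopology.

(** The base consists of the images of balls with centre in a countable dense set and radius
    1/(k+1). Interiors of balls are taken so that openness of [proj] applies. *)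
Lemma projective_second_countable (C : numClosedFieldType) (m : nat)
    (Q : countType) (f : Q -> C) :
  (forall z e : C, 0 < e -> exists q, `|z - f q| < e) ->
  (forall e : C, 0 < e -> exists k : nat, k.+1%:R^-1 < e) ->
  @second_countable (projective_space C m).
Proof.
move=> dense arch.
pose D (i : 'rV[Q]_m.+1 * nat) : set 'rV[C]_m.+1 :=
  (ball (map_mx f i.1) i.2.+1%:R^-1)°.
pose B i : set (projective_space C m) :=
  @proj C m @` (val @^-1` D i).
exists (range B); first exact: sub_countable (card_image_le _ _) (countableP _).
split=> [_ [i _ <-]|q A].
  apply: proj_open; rewrite openE => v Dv; apply: near_val.
  by apply: open_nbhs_nbhs; split=> //; exact: open_interior.
have [v <-] := proj_surj q => /proj_nbhs/sub_nbhsP[N /nbhs_ballP[e /= e0 eN] NA].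
have [k ke] : exists k : nat, k.+1%:R^-1 < e / 2.
  by apply: arch; rewrite divr_gt0.
have k0 : 0 < k.+1%:R^-1 :> C by rewrite invr_gt0 ltr0n.
have k2 : 0 < k.+1%:R^-1 / 2 :> C by rewrite divr_gt0.
(* A centre within half the radius of v keeps v in the interior of the ball; a radius below e / 2
   keeps the ball within e of v. *)
have /choice[d dP] (j : 'I_m.+1) : exists q,
    `|val v ord0 j - f q| < k.+1%:R^-1 / 2.
  exact: dense.
have vd : ball (map_mx f (\row_j d j)) (k.+1%:R^-1 / 2) (val v).
  apply: ball_sym; split=> // i j; rewrite !mxE ord1 -ball_normE; exact: dP.
exists (B (\row_j d j, k)).
  split; first by exists (\row_j d j, k).
  exists v => //; apply/nbhs_ballP; exists (k.+1%:R^-1 / 2) => //= x vx.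
  by rewrite [_^-1]splitr; exact: ball_triangle vd vx.
move=> _ [w /interior_subset wD <-]; apply: NA; apply: eN.
rewrite [e]splitr; apply: (@ball_triangle _ _ (map_mx f (\row_j d j))).
  apply: ball_sym; apply: le_ball vd; apply: ltW; apply: lt_trans ke.
  by rewrite ltr_pdivrMr // ltr_pMr // ltr1n.
exact: le_ball (ltW ke) _ wD.
Qed.

(** * Exterior algebras of free modules *)

Section ExteriorTheory.
Variables (A : comPzRingType) (M : lmodType A).
Local Notation L := (exterior M).

Lemma ext_genD_eq (x y : M) : ext_gen (x + y) = ext_gen x + ext_gen y.
Proof. by rewrite -ext_piD; apply/ext_piP; exact: ext_genD. Qed.

Lemma ext_genZ_eq a (x : M) : ext_gen (a *: x) = ext_scal M a * ext_gen x.
Proof. by rewrite -ext_piM; apply/ext_piP; exact: ext_genZ. Qed.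

Lemma ext_gen0 : ext_gen (0 : M) = 0.
Proof. by rewrite -(scale0r 0) ext_genZ_eq rmorph0 mul0r. Qed.

Lemma ext_gen_sum (I : Type) (r : seq I) (a : I -> A) (x : I -> M) :
  ext_gen (\sum_(i <- r) a i *: x i) =
  \sum_(i <- r) ext_scal M (a i) * ext_gen (x i).
Proof.
elim: r => [|i r IH]; first by rewrite !big_nil ext_gen0.
by rewrite !big_cons ext_genD_eq IH ext_genZ_eq.
Qed.

Lemma ext_gen_alt (x : M) : ext_gen x * ext_gen x = 0.
Proof. by rewrite -ext_piM; apply/ext_piP; exact: ext_alt. Qed.

(** Polarization: expand the square of x + y. *)
Lemma ext_gen_anti (x y : M) : ext_gen x * ext_gen y = - (ext_gen y * ext_gen x).
Proof.
have := ext_gen_alt (x + y); rewrite ext_genD_eq mulrDl !mulrDr !ext_gen_alt.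
by rewrite add0r addr0 => /eqP; rewrite addr_eq0 => /eqP.
Qed.

Lemma ext_scal_central a (x : L) : ext_scal M a * x = x * ext_scal M a.
Proof.
by elim/ext_ind: x => t; rewrite -!ext_piM; apply/ext_piP; exact: ext_scalC.
Qed.

Lemma ext_homog0 p : ext_homog p (0 : L).
Proof. by exists (EScal 0) => //; exact: ext_par0. Qed.

Lemma ext_homogD p (x y : L) : ext_homog p x -> ext_homog p y -> ext_homog p (x + y).
Proof.
move=> [s ps ->] [t pt ->]; exists (EAdd s t); first exact: ext_par_add.
by rewrite ext_piD.
Qed.

Lemma ext_homogM p q (x y : L) : ext_homog p x -> ext_homog q y ->
  ext_homog (p (+) q) (x * y).
Proof.
move=> [s ps ->] [t pt ->]; exists (EMul s t); first exact: ext_par_mul.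
by rewrite ext_piM.
Qed.

Lemma ext_homog_scal a : ext_homog false (ext_scal M a).
Proof. by exists (EScal a) => //; exact: ext_par_scal. Qed.

Lemma ext_homog_word n (e : 'I_n -> M) s :
  ext_homog (odd (size s)) (word (fun j => ext_gen (e j)) s).
Proof.
elim: s => [|j s IH]; rewrite /word ?big_nil ?big_cons /=.
  by rewrite -(rmorph1 (ext_scal M)); exact: ext_homog_scal.
rewrite -addTb; apply: ext_homogM => //; exists (EGen (e j)) => //.
exact: ext_par_gen.
Qed.

Lemma exterior_spanned n (e : 'I_n -> M) :
  (forall x, exists a : 'I_n -> A, x = \sum_j a j *: e j) ->
  forall x : L, spanned (ext_scal M) (fun j => ext_gen (e j)) x.
Proof.
move=> gen x.
have alt j : ext_gen (e j) * ext_gen (e j) = 0 by exact: ext_gen_alt.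
have anti j k : ext_gen (e j) * ext_gen (e k) = - (ext_gen (e k) * ext_gen (e j)).
  exact: ext_gen_anti.
(* Closure of the span under products is not at hand, so the induction is on a term acting by left
   multiplication; a product of terms then acts by composition. *)
have mul t y : spanned (ext_scal M) (fun j => ext_gen (e j)) y ->
    spanned (ext_scal M) (fun j => ext_gen (e j)) (ext_pi t * y).
  elim: t y => [a|z|s IHs t IHt|s IHs t IHt] y sy.
  - exact: spanned_sc.
  - have [a ->] := gen z; rewrite -/(ext_gen _) ext_gen_sum mulr_suml.
    apply: big_ind => [||j _]; [exact: spanned0|exact: spannedD|].
    rewrite -mulrA; apply: spanned_sc.
    exact: (spanned_e ext_scal_central alt anti).
  - by rewrite ext_piD mulrDl; apply: spannedD; [exact: IHs|exact: IHt].
  - by rewrite ext_piM -mulrA; apply/IHs/IHt.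
elim/ext_ind: x => t; rewrite -[ext_pi t]mulr1; apply: mul.
exact: spanned1.
Qed.
End ExteriorTheory.

(** * The universal property of the exterior algebra *)

Section ExteriorLift.
Variables (A : comPzRingType) (M : lmodType A) (S : pzRingType).
Variables (sc : {rmorphism A -> S}) (g : M -> S).

Definition alternating_map :=
  [/\ forall a x, sc a * x = x * sc a,
      forall x y, g (x + y) = g x + g y,
      forall a x, g (a *: x) = sc a * g x &
      forall x, g x * g x = 0].

Fixpoint ext_eval (t : ext_term M) : S :=
  match t with
  | EScal a => sc a
  | EGen x => g x
  | EAdd s t => ext_eval s + ext_eval t
  | EMul s t => ext_eval s * ext_eval t
  end.

(** The proof is an argument so that the morphism instances below attach to [ext_lift g_alt]. *)
Definition ext_lift (_ : alternating_map) (x : exterior M) : S :=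
  ext_eval (repr (x : {eq_quot @ext_eqb A M})).

Hypothesis g_alt : alternating_map.

Lemma ext_eval_eq s t : ext_eq s t -> ext_eval s = ext_eval t.
Proof.
have [cen gD gZ alt] := g_alt.
elim=> {s t} /=; try by intros; congruence.
- by move=> s t u; rewrite addrA.
- by move=> s t; rewrite addrC.
- by move=> s; rewrite rmorph0 add0r.
- by move=> s; rewrite rmorphN1 mulN1r addNr rmorph0.
- by move=> s t u; rewrite mulrA.
- by move=> s; rewrite rmorph1 mul1r.
- by move=> s t u; rewrite mulrDl.
- by move=> s t u; rewrite mulrDr.
- by move=> a c; rewrite rmorphD.
- by move=> a c; rewrite rmorphM.
- by move=> x; rewrite alt rmorph0.
Qed.

Lemma ext_liftE t : ext_lift g_alt (ext_pi t) = ext_eval t.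
Proof. by apply/ext_eval_eq/ext_piP; exact: reprK. Qed.

Lemma ext_lift_zmod : zmod_morphism (ext_lift g_alt).
Proof.
have D s t : ext_lift g_alt (s + t) = ext_lift g_alt s + ext_lift g_alt t.
  elim/ext_ind: s => s; elim/ext_ind: t => t.
  by rewrite -ext_piD !ext_liftE.
by move=> x y; apply/(addIr (ext_lift g_alt y)); rewrite -D !subrK.
Qed.

Lemma ext_lift_monoid : monoid_morphism (ext_lift g_alt).
Proof.
split; first by rewrite ext_liftE /= rmorph1.
elim/ext_ind=> s; elim/ext_ind=> t.
by rewrite -ext_piM !ext_liftE.
Qed.
HB.instance Definition _ :=
  GRing.isZmodMorphism.Build _ _ (ext_lift g_alt) ext_lift_zmod.
HB.instance Definition _ :=
  GRing.isMonoidMorphism.Build _ _ (ext_lift g_alt) ext_lift_monoid.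
End ExteriorLift.

(** * The splitting *)

Lemma differentiable_exprz (K : numFieldType) (V : normedModType K) (f : V -> K)
    (k : int) (x : V) : differentiable f x -> f x != 0 ->
  differentiable (fun y => f y ^ k) x.
Proof.
have pow (j : nat) : differentiable f x -> differentiable (fun y => f y ^+ j) x.
  case: j => [|j] df; first by under eq_fun do rewrite expr0; exact: differentiable_cst.
  by rewrite (_ : (fun _ => _) = f ^+ j.+1); [exact: differentiableX|rewrite exprfctE].
move=> df fx; case: k => j; first exact: pow.
by apply: differentiableV; [exact: pow|rewrite expf_neq0].
Qed.

Section Frames.
Variables (C : numClosedFieldType) (m : nat).
Local Notation P := (projective_space C m).
Local Notation V := (punctured C m).
Local Notation OP := (projective_sheaf C m).
Local Notation OV := (punctured_sheaf C m).
Local Notation proj := (@proj C m).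

Lemma cone_point (U : opens P) (x : U) : exists v : cone U, cone_proj v = x.
Proof.
have [v vx] := proj_surj (val x).
have Uv : oset (cone U) v.
  by rewrite /= /preimage /= vx; exact: set_mem (valP x).
by exists (exist _ v (mem_set Uv)); apply: val_inj.
Qed.

Lemma pullback_inj (U : opens P) : injective (@pullback C m U).
Proof.
move=> f g e; apply: regfunP => x; have [v <-] := cone_point x.
by have /= := congr1 (fun r : regfun OV (cone U) => r v) e.
Qed.

(** Degree 0 means constant along each punctured line, so any choice of vectors over the points
    defines the same function on U. It is regular because regularity on P is tested on the pullback,
    which is f. *)
Lemma descend (U : opens P) (f : regfun OV (cone U)) :
  f \in @homogeneous C m 0 U ->
  exists g : regfun OP U, pullback g = f.
Proof.
move=> /asboolP hf.
have /choice[r rP] : forall x : U, exists v : cone U, cone_proj v = x.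
  exact: cone_point.
pose g (x : U) := f (r x).
have gE (v : cone U) : g (cone_proj v) = f v.
  have /projP[l l0 e] : proj (val (r (cone_proj v))) = proj (val v).
    by have /= := congr1 val (rP (cone_proj v)).
  by rewrite /g (hf l (r (cone_proj v)) v) // expr0z mul1r.
pose G q := odflt 0 (omap g (insub q)).
have GE (x : U) : G (val x) = g x by rewrite /G valK.
have [F hF fF] := rfunE f.
have gr : g \in regular OP U.
  apply/asboolP; exists G => [q Uq|x]; last by rewrite GE.
  have : \forall q' \near q, oset U q' by exact: opens_near.
  apply: filterS => q' Uq' v vq'; subst q'.
  apply: hol_near (hF v Uq').
  have : \forall w \near v, oset (cone U) w by exact: opens_near.
  apply: filterS => w Uw; pose w' : cone U := exist _ w (mem_set Uw).
  by rewrite -[w]/(val w') -fF -gE -GE.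
exists (Regfun gr); apply: regfunP => v; exact: gE.
Qed.

Variable i : 'I_m.+1.

Section OnOpen.
Variable (U : opens P).
Hypothesis Ui : U `<=` standard_open C i.

Lemma cone_coord_neq0 (v : cone U) : val (val v) ord0 i != 0.
Proof.
have := Ui (set_mem (valP v) : oset U (proj (val v))).
by move=> /standard_openP.
Qed.

Lemma coord_power_subproof (k : int) :
  (fun v : cone U => val (val v) ord0 i ^ k) \in regular OV (cone U).
Proof.
apply/asboolP; exists (fun v : V => val v ord0 i ^ k) => // v Uv.
have vi := cone_coord_neq0 (exist _ v (mem_set Uv)).
exists (fun x : 'rV[C]_m.+1 => x ord0 i ^ k) => //; last by near=> w.
have := coord_neq0_near vi; apply: filterS => x xi.
exact: differentiable_exprz (differentiable_coord _ _ _) xi.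
Unshelve. all: by end_near. Qed.

Definition coord_power k : regfun OV (cone U) := Regfun (coord_power_subproof k).

Lemma coord_powerD k l : coord_power (k + l) = coord_power k * coord_power l.
Proof.
by apply: regfunP => v; rewrite rfunM /= expfzDr // cone_coord_neq0.
Qed.

Lemma coord_power0 : coord_power 0 = 1.
Proof. by apply: regfunP => v; rewrite /= expr0z. Qed.

Lemma coord_power_homogeneous k : coord_power k \in @homogeneous C m k U.
Proof.
by apply/asboolP => l v w l0 e; rewrite /= e mxE expfzMl.
Qed.

Lemma homogeneousM k l (f g : regfun OV (cone U)) :
  f \in @homogeneous C m k U ->
  g \in @homogeneous C m l U ->
  f * g \in @homogeneous C m (k + l) U.
Proof.
move=> /asboolP hf /asboolP hg; apply/asboolP => c v w c0 e.
by rewrite !rfunM (hf c v w) // (hg c v w) // expfzDr // mulrACA.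
Qed.

Lemma coord_powerK k (f g : regfun OV (cone U)) :
  f * coord_power k = g -> f = g * coord_power (- k).
Proof. by move=> <-; rewrite -mulrA -coord_powerD subrr coord_power0 mulr1. Qed.

(** Dividing by the k-th power of coordinate i, a unit over the chart, leaves degree 0, and such
    functions descend. *)
Lemma homogeneous_frame k (f : regfun OV (cone U)) :
  f \in @homogeneous C m k U ->
  exists! a : regfun OP U, f = pullback a * coord_power k.
Proof.
move=> hf; have hf0 := homogeneousM hf (coord_power_homogeneous (- k)).
rewrite subrr in hf0; have [a aE] := descend hf0; exists a; split.
  by rewrite aE -mulrA -coord_powerD addNr coord_power0 mulr1.
by move=> a' /esym /coord_powerK aE'; apply: pullback_inj; rewrite aE aE'.
Qed.
End OnOpen.

End Frames.

(** * Gluing on cones *)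

Section ConeSheaf.
Variables (C : numClosedFieldType) (m : nat).
Local Notation P := (projective_space C m).
Local Notation OP := (projective_sheaf C m).
Local Notation OV := (punctured_sheaf C m).

Lemma cone_sheaf : is_sheaf (F := fun U : opens P => regfun OV (cone U))
  (fun U V h => rres (cone_sub h)).
Proof.
move=> U I W WU cov s compat.
have [||t [tE uniq]] := regfun_sheaf (A := OV) (U := cone U)
  (W := fun i => cone (W i)) (fun i => cone_sub (WU i)) _ (s := s).
- by move=> v /cov[i _ Wi]; exists i.
(* Here V is any open set upstairs, perhaps not a cone, while compatibility is known only on cones;
   V lies in the cone of the intersection, where it applies. *)
- move=> i j V hi hj; pose Wij := opensI (W i) (W j).
  have ki : Wij `<=` W i by move=> ? [].
  have kj : Wij `<=` W j by move=> ? [].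
  have l : V `<=` cone Wij by move=> v Vv; split; [exact: hi|exact: hj].
  rewrite -(rres_comp (cone_sub ki) l) -(rres_comp (cone_sub kj) l).
  by rewrite (compat i j Wij ki kj).
by exists t.
Qed.

(** Homogeneity relates vectors that may be far apart, yet it can be checked on a cover of P:
    proportional vectors lie over one point, hence in the cone of a common member. *)
Lemma cone_local (U : opens P) (I : Type) (W : I -> opens P)
    (WU : forall i, W i `<=` U) (l : C) (v w : cone U) :
  U `<=` \bigcup_i W i -> l != 0 -> val (val w) = l *: val (val v) ->
  exists i (v' w' : cone (W i)),
    [/\ incl (cone_sub (WU i)) v' = v, incl (cone_sub (WU i)) w' = w &
      val (val w') = l *: val (val v')].
Proof.
move=> cov l0 e; have [i _ Wv] := cov _ (set_mem (valP v) : oset (cone U) (val v)).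
have Wv' : oset (cone (W i)) (val v) by [].
have Ww' : oset (cone (W i)) (val w).
  rewrite /= /preimage /= (_ : proj _ = proj (val v)) //.
  by apply/esym/projP; exists l.
exists i, (exist _ (val v) (mem_set Wv')), (exist _ (val w) (mem_set Ww')).
by split=> //; exact: val_inj.
Qed.

Lemma twisting_sheafP k : is_sheaf (mres (o := twisting_sheaf C m k)).
Proof.
move=> U I W WU cov s compat.
have [|t [tE uniq]] := cone_sheaf WU cov (s := fun i => twist_val (s i)).
  by move=> i j V hi hj; have /(congr1 val) := compat i j V hi hj.
have th : t \in @homogeneous C m k U.
  apply/asboolP => l v w l0 e.
  have [i [v' [w' [<- <- e']]]] := cone_local WU cov l0 e.
  have st (x : cone (W i)) : t (incl (cone_sub (WU i)) x) = twist_val (s i) x.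
    by rewrite -tE.
  have /asboolP hs := twist_valP (s i).
  by rewrite !st (hs l v' w').
exists (TwistSec th); split=> [i|t' ht']; apply: val_inj; first exact: tE.
by apply: uniq => i; rewrite -ht'.
Qed.
End ConeSheaf.

Lemma omodule_dsum_sheaf (C : numClosedFieldType) (X : topologicalType)
    (A : function_sheaf C X) (J : finType) (E : J -> omodule A) :
  (forall j, is_sheaf (mres (o := E j))) ->
  is_sheaf (mres (o := omodule_dsum E)).
Proof.
move=> sh U I W WU cov s compat.
have /all_sig[t tP] j : {t | (forall i, mres (WU i) t = s i j) /\
    forall t', (forall i, mres (WU i) t' = s i j) -> t = t'}.
  apply: cid; have [|t [tE uniq]] := sh j U I W WU cov (fun i => s i j).
    move=> i k V hi hk.
    exact: (congr1 (fun r : dsum (fun j => E j V) => r j) (compat i k V hi hk)).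
  by exists t.
exists (t : omodule_dsum E U); split=> [i|t' ht'].
  by apply: functional_extensionality_dep => j; have [] := tP j.
apply: functional_extensionality_dep => j.
by have [_] := tP j; apply=> i; rewrite -ht'.
Qed.

Section SuperspaceSheaf.
Variables (C : numClosedFieldType) (m n : nat) (b : 'I_n -> int).
Local Notation P := (projective_space C m).
Local Notation OV := (punctured_sheaf C m).
Local Notation F := (ssheaf (projective_superspace C m b)).

Lemma superspace_sheaf : is_sheaf (fun U V h => pres h : F U -> F V).
Proof.
move=> U I W WU cov s compat.
have /all_sig[t tP] (K : {set 'I_n}) : {t : regfun OV (cone U) |
    (forall i, rres (cone_sub (WU i)) t = ps_val (s i) K) /\
    forall t', (forall i, rres (cone_sub (WU i)) t' = ps_val (s i) K) -> t = t'}.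
  apply: cid; have [|t [tE uniq]] := cone_sheaf WU cov (s := fun i => ps_val (s i) K).
    move=> i j V hi hj.
    have /(congr1 (fun r : ps_sec b V => ps_val r K)) := compat i j V hi hj.
    by rewrite /= !ffunE.
  by exists t.
pose g : grassmann n (regfun OV (cone U)) := [ffun K => t K].
have gi : g \in @invariant C m n b U.
  apply/asboolP => l v w l0 e K; rewrite ffunE.
  have [i [v' [w' [<- <- e']]]] := cone_local WU cov l0 e.
  have st (x : cone (W i)) : t K (incl (cone_sub (WU i)) x) = ps_val (s i) K x.
    by have [<-] := tP K.
  have /asboolP hs := ps_valP (s i).
  by rewrite !st (hs l v' w').
exists (PsSec gi); split=> [i|t' ht']; apply: val_inj; apply/ffunP => K.
  by rewrite /= !ffunE; have [] := tP K.
rewrite /= ffunE; have [_] := tP K; apply=> i.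
by rewrite -ht' /= ffunE.
Qed.
End SuperspaceSheaf.

Lemma ghomogM (n : nat) (A : comPzRingType) (p q : bool) (f g : grassmann n A) :
  ghomog p f -> ghomog q g -> ghomog (p (+) q) (f * g).
Proof.
move=> hf hg K oK; rewrite gmulE big1 // => I IK.
have [oI|oI] := eqVneq (odd #|I|) p; last by rewrite hf // mul0r mulr0.
rewrite [g _]hg ?mulr0 //; apply: contra oK => /eqP oKI.
have : odd #|K| = odd #|I| (+) odd #|K :\: I|.
  by rewrite -oddD cardsDS // subnKC // subset_leq_card.
by rewrite oI oKI => ->.
Qed.

(** * Supercommutativity and local rings of the projective superspace *)

Section SuperspaceRing.
Variables (C : numClosedFieldType) (m n : nat) (b : 'I_n -> int).
Local Notation P := (projective_space C m).
Local Notation OP := (projective_sheaf C m).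
Local Notation OV := (punctured_sheaf C m).
Local Notation F := (ssheaf (projective_superspace C m b)).

Lemma superspace_supercommutative (U : opens P) :
  supercommutative (pscal F U) (@ppar _ _ F U).
Proof.
split.
- split=> [p I _|p c s t ps pt I oI]; first by rewrite ffunE.
  rewrite -[ps_val _]/(gscal n (rcst OV (cone U) c) * ps_val s + ps_val t).
  by rewrite ffunE /= gscal_mulE (ps I oI) (pt I oI) mulr0 addr0.
- split=> [I oI|p q s t ps pt]; last exact: ghomogM.
  by rewrite ffunE; case: (I =P _) oI => [->|//]; rewrite finset.cards0.
- move=> s; pose part (p : bool) : grassmann n (regfun OV (cone U)) :=
    [ffun I : {set 'I_n} => if odd #|I| == p then ps_val s I else 0].
  have inv p : part p \in @invariant C m n b U.
    have /asboolP hs := ps_valP s; apply/asboolP => l v w l0 e I.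
    by rewrite ffunE; case: eqP => _; [exact: hs|rewrite !rfun0 mulr0].
  have hp p : ghomog p (part p) by move=> I /negbTE oI; rewrite ffunE oI.
  exists (PsSec (inv false)), (PsSec (inv true)); split; [exact: hp|exact: hp|].
  apply: val_inj; apply/ffunP => I; rewrite [RHS]ffunE !ffunE.
  by case: (odd _); rewrite /= ?add0r ?addr0.
- move=> s p0 p1; apply: val_inj; apply/ffunP => I; rewrite [RHS]ffunE.
  by have [oI|oI] := boolP (odd #|I|); [apply: p0; rewrite oI|apply: p1; rewrite (negbTE oI)].
- move=> p q s t ps pt; apply: val_inj.
  rewrite -[LHS]/(ps_val s * ps_val t) (grassmann_supercommutative ps pt).
  by case: (p && q); rewrite ?expr0 ?expr1 ?mul1r ?mulN1r.
Qed.

Lemma regular_inv (U : opens (punctured C m)) (f : regfun OV U) :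
  (forall v, f v != 0) -> (fun v : U => (f v)^-1) \in regular OV U.
Proof.
move=> f0; have [F hF fF] := rfunE f.
apply/asboolP; exists (fun v => (F v)^-1) => [v Uv|v]; last by rewrite fF.
have [G hG FG] := hF v Uv; exists (fun x => (G x)^-1); last first.
  by apply: filterS FG => w ->.
have Gv : G (val v) != 0.
  rewrite -(nbhs_singleton FG).
  by have := f0 (exist _ v (mem_set Uv)); rewrite fF.
have dG := nbhs_singleton hG.
have Gn : \forall x \near val v, G x != 0.
  exact: differentiable_continuous dG _ (nbhs_neq0 Gv).
apply: filterS2 hG Gn => x dx Gx; exact: differentiableV.
Qed.

(** The pullback has a differentiable, hence continuous, local extension, so it is nonzero near a
    vector over x; the image of that region under the open map [proj] contains a suitable
    neighbourhood. *)
Lemma nonvanishing_nbhd (U : opens P) (a : regfun OP U) (x : U) : a x != 0 ->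
  exists (W : opens P) (h : W `<=` U), oset W (val x) /\
    forall y : W, rres h a y != 0.
Proof.
move=> ax; have [v vx] := cone_point x.
have [F hF fF] := rfunE (pullback a).
have Uv : oset (cone U) (val v) := set_mem (valP v).
have [G hG FG] := hF (val v) Uv.
have Gv : G (val (val v)) != 0.
  by rewrite -(nbhs_singleton FG) -fF /= vx.
have Gn : \forall y \near val (val v), G y != 0.
  exact: differentiable_continuous (nbhs_singleton hG) _ (nbhs_neq0 Gv).
have : \forall w \near val v, oset (cone U) w /\ F w != 0.
  have Un : \forall w \near val v, oset (cone U) w by exact: opens_near.
  by apply: filterS3 Un FG (near_val Gn) => w Uw -> Gw.
move=> /proj_nbhs_image; rewrite nbhsE => -[S [oS Sv] SF].
have h : Opens oS `<=` U by move=> q /SF[w [Uw _] <-].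
exists (Opens oS), h; split; first by rewrite -vx.
move=> y; have Sy : S (val y) := set_mem (valP y).
have [w [Uw Fw] wy] := SF _ Sy.
pose w' : cone U := exist _ w (mem_set Uw).
have : pullback a w' != 0 by rewrite fF.
by congr (a _ != 0); apply: val_inj.
Qed.

(** A section is invertible near x when its body, the coefficient of the empty set, is nonzero over
    x; for any s, the body of s or that of 1 - s is. The body has degree 0, so it descends to P and
    stays nonzero on a neighbourhood. *)
Lemma superspace_local_ring (x : P) : local_ring (stalk F x).
Proof.
apply: stalk_local_ring => [U Ux e|U s Ux].
  have [v _] := cone_point (exist _ x (mem_set Ux) : U).
  have := congr1 (fun r : ps_sec b U => ps_val r finset.set0 v) e.
  by rewrite /= !ffunE eqxx => /eqP; rewrite oner_eq0.
have unitP (g : ps_sec b U) (v : cone U) : proj (val v) = x ->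
    ps_val g finset.set0 v != 0 -> locally_unit (F := F) x g.
  move=> vx gv; have /asboolP hg := ps_valP g.
  have h0 : ps_val g finset.set0 \in @homogeneous C m 0 U.
    apply/asboolP => l y z l0 e; have := hg l y z l0 e finset.set0.
    by rewrite finset.big_set0 expr0z !mul1r.
  have [a aE] := descend h0.
  have [|W [h [Wx Wa]]] := @nonvanishing_nbhd U a (cone_proj v).
    by have := congr1 (fun r : regfun OV (cone U) => r v) aE; rewrite /= => ->.
  rewrite /= vx in Wx.
  have Wg y : ps_val (ps_res h g) finset.set0 y != 0.
    rewrite /= ffunE -aE /=; have := Wa (cone_proj y).
    by congr (a _ != 0); apply: val_inj.
  pose u := ps_val (ps_res h g) finset.set0.
  pose r : regfun OV (cone W) := Regfun (regular_inv Wg).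
  have ru : r * u = 1 by apply: regfunP => y; rewrite rfunM /= mulVf.
  have hr : gscal n r \in @invariant C m n b W.
    apply/asboolP => l y z l0 e I; rewrite ffunE; case: eqP => [->|_]; last first.
      by rewrite !rfun0 mulr0.
    have /asboolP hgW := ps_valP (ps_res h g).
    have := hgW l y z l0 e finset.set0; rewrite !finset.big_set0 !mul1r.
    by move=> /= ->.
  have hu : gscal n u \in @invariant C m n b W.
    apply/asboolP => l y z l0 e I; rewrite ffunE; case: eqP => [->|_]; last first.
      by rewrite !rfun0 mulr0.
    have /asboolP hgW := ps_valP (ps_res h g).
    exact: hgW l y z l0 e finset.set0.
  pose R := PsSec hr; pose Q := PsSec hu; pose G := ps_res h g.
  have RQ : R * Q = 1 by apply: val_inj; rewrite /= -rmorphM ru rmorph1.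
  have QR : Q * R = 1 by apply: val_inj; rewrite /= -rmorphM mulrC ru rmorph1.
  (* [R] inverts the body of [G], so [N] has body 0 and is nilpotent; hence [R] * [G] = 1 - [N] is a
     unit. *)
  pose N := 1 - R * G.
  have N0 : N ^+ n.+1 = 0.
    apply: val_inj; rewrite rmorphXn; apply: grassmann_nilpotent.
    rewrite rmorphB rmorphM rmorph1 ffunE [gone _ _ _]ffunE eqxx.
    by rewrite [(- _ : {ffun _}) _]ffunE gscal_mulE ru subrr.
  have [t [tl tr]] := one_sub_nilpotent N0.
  have NE : 1 - N = R * G by rewrite /N opprB addrC subrK.
  rewrite NE in tl tr.
  exists W, h, (t * R); split=> //=; first by rewrite -mulrA.
  (* For the right inverse, insert [Q] * [R] = 1 in front so that [R] * [G] * t = 1 can be used. *)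
  rewrite -/G -[LHS]mul1r -QR -[Q * R * _]mulrA [R * _]mulrA [R * G * _]mulrA.
  by rewrite tr mul1r QR.
have [v vx] := cone_point (exist _ x (mem_set Ux) : U).
have pvx : proj (val v) = x by have := congr1 val vx.
have [s0|s0] := eqVneq (ps_val s finset.set0 v) 0; last by left; exact: unitP s0.
right; apply: (unitP _ v) => //.
have -> : ps_val (1 - s) finset.set0 = 1 - ps_val s finset.set0.
  rewrite -[ps_val (1 - s)]/(1 - ps_val s) ffunE [gone _ _ _]ffunE eqxx.
  by rewrite ffunE.
by rewrite rfunB s0 subr0 rfun1 oner_neq0.
Qed.
End SuperspaceRing.

Lemma dsum_sumE (J : Type) (A : pzRingType) (M : J -> lmodType A) (I : Type)
    (r : seq I) (s : I -> dsum M) (j : J) :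
  (\sum_(i <- r) s i) j = \sum_(i <- r) s i j.
Proof.
elim: r => [|i r IH]; first by rewrite !big_nil.
by rewrite !big_cons -IH.
Qed.

(** * The morphism from the exterior algebra and its inverse on charts *)

Section Splitting.
Variables (C : numClosedFieldType) (m n : nat) (b : 'I_n -> int).
Local Notation P := (projective_space C m).
Local Notation OP := (projective_sheaf C m).
Local Notation OV := (punctured_sheaf C m).
Local Notation E := (omodule_dsum (fun j : 'I_n => twisting_sheaf C m (- b j))).
Local Notation F := (ssheaf (projective_superspace C m b)).

Section OnOpen.
Variable U : opens P.

Lemma ps_scalar_subproof (a : regfun OP U) :
  gscal n (pullback a) \in @invariant C m n b U.
Proof.
apply/asboolP => l v w l0 e I; rewrite ffunE; case: eqP => [->|_]; last first.
  by rewrite !rfun0 mulr0.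
rewrite finset.big_set0 mul1r; congr (rfun a _); apply: val_inj => /=.
by apply/esym/projP; exists l.
Qed.

Definition ps_scalar (a : regfun OP U) : ps_sec b U := PsSec (ps_scalar_subproof a).

Lemma ps_scalar_zmod : zmod_morphism ps_scalar.
Proof. by move=> c d; apply: val_inj; rewrite /= !rmorphB. Qed.
Lemma ps_scalar_monoid : monoid_morphism ps_scalar.
Proof. by split=> [|c d]; apply: val_inj; rewrite /= ?rmorph1 ?rmorphM. Qed.
HB.instance Definition _ := GRing.isZmodMorphism.Build
  (regfun OP U) (ps_sec b U) ps_scalar ps_scalar_zmod.
HB.instance Definition _ := GRing.isMonoidMorphism.Build
  (regfun OP U) (ps_sec b U) ps_scalar ps_scalar_monoid.

(** The factor l^(b j) from theta_j cancels the degree - b j of the coefficient. *)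
Lemma ps_odd_subproof (s : E U) :
  glin (fun j => twist_val (s j)) \in @invariant C m n b U.
Proof.
apply/asboolP => l v w l0 e I.
have [I1|I1] := eqVneq #|I| 1%N; last first.
  by rewrite glin_card // !rfun0 mulr0.
have /finset.cards1P[j ->] : #|I| == 1%N by rewrite I1.
rewrite glin1 finset.big_set1.
have /asboolP hs := twist_valP (s j).
by rewrite (hs l v w) // mulrA -expfzDr // subrr expr0z mul1r.
Qed.

Definition ps_odd (s : E U) : ps_sec b U := PsSec (ps_odd_subproof s).

Lemma ps_odd_alternating : alternating_map ps_scalar ps_odd.
Proof.
split=> [a x|x y|a x|x]; apply: val_inj.
- exact: gscalC.
- exact: glinD.
- exact: glinZ.
(* Regular functions have no 2-torsion because their values lie in a field of characteristic 0. *)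
- apply: glin_alt => f f2; apply: regfunP => v.
  have := congr1 (fun r : regfun OV (cone U) => r v) f2.
  by rewrite mulr2n rfunD rfun0 -mulr2n => /eqP; rewrite mulrn_eq0 => /eqP.
Qed.

Definition splitting : {rmorphism exterior (E U) -> ps_sec b U} :=
  ext_lift ps_odd_alternating.

Lemma splitting_par p x : ext_homog p x -> ghomog p (ps_val (splitting x)).
Proof.
move=> [t pt ->]; rewrite [splitting _]ext_liftE.
elim: pt => {p t} /= [a|p|s|p s t _ IHs _ IHt|p q s t _ IHs _ IHt].
- by move=> I oI; rewrite ffunE; case: (I =P _) oI => [->|//]; rewrite finset.cards0.
- by move=> I oI; rewrite rmorph0 ffunE; case: eqP.
- exact: glin_homog.
- by move=> I oI; rewrite ffunE (IHs I oI) (IHt I oI) addr0.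
- exact: ghomogM.
Qed.
End OnOpen.

Lemma splitting_res (U W : opens P) (h : W `<=` U) x :
  splitting W (@ext_pres C P OP E U W h x) = ps_res h (splitting U x).
Proof.
elim/ext_ind: x => t; rewrite [@ext_pres _ _ _ _ _ _ _ _]ext_morE ![splitting _ _]ext_liftE.
elim: t => /= [a|s|s -> t ->|s -> t ->]; rewrite ?rmorphD ?rmorphM //.
  apply: val_inj; apply/ffunP => I; rewrite /= !ffunE; case: eqP => _; last by rewrite rmorph0.
  by apply: regfunP => v /=; congr (rfun a _); apply: val_inj.
apply: val_inj; apply/ffunP => I; rewrite /= !ffunE raddf_sum; apply: eq_bigr => j _.
by case: eqP => _; rewrite ?raddf0.
Qed.

Lemma splitting_scal U c : splitting U (ext_pscal E U c) = ps_cst b U c.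
Proof.
rewrite [splitting _ _]ext_liftE; apply: val_inj; apply/ffunP => I.
by rewrite /= !ffunE; case: eqP => // _; exact: regfunP.
Qed.

Section OnChart.
Variables (i : 'I_m.+1) (U : opens P).
Hypothesis Ui : U `<=` standard_open C i.

Definition frame (j : 'I_n) : E U := fun k =>
  if k == j then TwistSec (coord_power_homogeneous Ui (- b k)) else 0.

Lemma frame_sumE (a : 'I_n -> regfun OP U) k :
  twist_val ((\sum_j a j *: frame j : E U) k) =
  pullback (a k) * coord_power Ui (- b k).
Proof.
rewrite dsum_sumE (eq_bigr (fun j => a j *: frame j k)) // (bigD1 k) //=.
rewrite big1 ?addr0 => [|j jk]; first by rewrite /frame eqxx.
by rewrite /frame eq_sym (negbTE jk) scaler0.
Qed.

Lemma frameP (s : E U) :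
  exists! a : 'I_n -> regfun OP U, s = \sum_j a j *: frame j.
Proof.
have /choice[a aP] j : exists a : regfun OP U,
    twist_val (s j) = pullback a * coord_power Ui (- b j) /\
    forall a', twist_val (s j) = pullback a' * coord_power Ui (- b j) -> a = a'.
  by have [a] := homogeneous_frame Ui (twist_valP (s j)); exists a.
exists a; split=> [|a' sE].
  apply: functional_extensionality_dep => j; apply: val_inj.
  by rewrite [RHS]frame_sumE; have [] := aP j.
apply/funext => j; have [_] := aP j; apply.
by rewrite sE frame_sumE.
Qed.

Lemma ps_val_word (f : 'I_n -> ps_sec b U) s :
  ps_val (word f s) = word (fun j => ps_val (f j)) s.
Proof.
rewrite /word; elim: s => [|j s IH]; first by rewrite !big_nil.
by rewrite !big_cons -IH.
Qed.

Lemma ps_val_sum (J : finType) (f : J -> ps_sec b U) K :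
  ps_val (\sum_j f j) K = \sum_j ps_val (f j) K.
Proof.
rewrite -!big_enum /=; elim: (enum J) => [|j s IH]; first by rewrite !big_nil ffunE.
rewrite !big_cons -IH.
by transitivity ((ps_val (f j) + ps_val (\sum_(i <- s) f i)) K); last by rewrite ffunE.
Qed.

Definition frame_comb (c : {set 'I_n} -> regfun OP U) : exterior (E U) :=
  \sum_I ext_scal (E U) (c I) * word (fun j => ext_gen (frame j)) (enum I).

Local Notation u := (fun j => coord_power Ui (- b j)).

Lemma splitting_word s :
  ps_val (splitting U (word (fun j => ext_gen (frame j)) s)) = word (gtheta u) s.
Proof.
have -> : splitting U (word (fun j => ext_gen (frame j)) s) =
    word (fun j => ps_odd (frame j)) s.
  rewrite /word; elim: s => [|j s IH]; first by rewrite !big_nil rmorph1.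
  by rewrite !big_cons rmorphM IH; congr (_ * _); exact: ext_liftE.
rewrite ps_val_word; congr word; apply/funext => j; rewrite /= /gtheta.
congr glin; apply/funext => k; rewrite /frame.
by case: eqP => [->|].
Qed.

(** On the chart the morphism is diagonal: the monomial of I has only a theta_I component, with a
    unit as coefficient. *)
Lemma splitting_frame (c : {set 'I_n} -> regfun OP U) K :
  ps_val (splitting U (frame_comb c)) K =
  pullback (c K) * \prod_(j in K) coord_power Ui (- b j).
Proof.
have term I : ps_val (splitting U (ext_scal (E U) (c I) *
    word (fun j => ext_gen (frame j)) (enum I))) K =
    if I == K then pullback (c K) * \prod_(j in K) u j else 0.
  rewrite rmorphM [splitting U (ext_scal _ _)]ext_liftE.
  rewrite -[ps_val _]/(gscal n (pullback (c I)) * ps_val (splitting U (word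
    (fun j => ext_gen (frame j)) (enum I)))) gscal_mulE splitting_word.
  rewrite gtheta_word ?enum_set_sorted // eq_sym.
  have -> : [set j in enum I]%SET = I by apply/setP => j; rewrite inE mem_enum.
  by case: eqP => [->|]; rewrite ?mulr0.
rewrite rmorph_sum ps_val_sum (eq_bigr _ (fun I _ => term I)) -big_mkcond.
by rewrite big_pred1_eq.
Qed.

Lemma splitting_onto (g : ps_sec b U) :
  exists c, splitting U (frame_comb c) = g.
Proof.
(* [w] I inverts the unit attached to theta_I, and its degree, the sum of the b j, brings the
   coefficient of g to degree 0, where it descends to U. *)
pose w (I : {set 'I_n}) := \prod_(j in I) coord_power Ui (b j).
have wu I : w I * \prod_(j in I) u j = 1.
  by rewrite -big_split big1 // => j _; rewrite /= -coord_powerD subrr coord_power0.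
have wE I (v : cone U) : w I v = \prod_(j in I) val (val v) ord0 i ^ b j.
  by rewrite /w; elim/big_rec2: _ => // j x y _ <-.
have /choice[c cE] I : exists a : regfun OP U, pullback a = ps_val g I * w I.
  apply: descend; apply/asboolP => l v v' l0 e.
  have /asboolP hg := ps_valP g.
  have ww : w I v' = (\prod_(j in I) l ^ b j) * w I v.
    rewrite !wE -big_split; apply: eq_bigr => j _.
    by rewrite /= e mxE expfzMl.
  by rewrite expr0z mul1r !rfunM ww -(hg l v v' l0 e I) mulrCA mulrA.
exists c; apply: val_inj; apply/ffunP => I.
by rewrite [LHS]splitting_frame cE -mulrA wu mulr1.
Qed.

Lemma frame_comb_onto x : exists c, x = frame_comb c.
Proof.
have gen (s : E U) : exists a : 'I_n -> regfun OP U, s = \sum_j a j *: frame j.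
  by have [a [sa _]] := frameP s; exists a.
exact: exterior_spanned gen x.
Qed.

Lemma frame_coeff0 (c : {set 'I_n} -> regfun OP U) K :
  ps_val (splitting U (frame_comb c)) K = 0 -> c K = 0.
Proof.
rewrite splitting_frame => cK; apply: pullback_inj; rewrite rmorph0.
rewrite -[LHS]mulr1 -(_ : \prod_(j in K) u j * \prod_(j in K) coord_power Ui (b j) = 1).
  by rewrite mulrA cK mul0r.
by rewrite -big_split big1 // => j _; rewrite /= -coord_powerD addNr coord_power0.
Qed.

(** Any x is a combination of monomials. If its image vanishes, so does each coefficient, by
    [frame_coeff0], and then x itself. *)
Lemma splitting_bijective : bijective (splitting U).
Proof.
have inj : injective (splitting U).
  apply: raddf_inj => x; have [c ->] := frame_comb_onto x => c0.
  rewrite /frame_comb big1 // => I _; rewrite (@frame_coeff0 c I).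
    by rewrite rmorph0 mul0r.
  by rewrite c0 ffunE.
have /choice[h hK] g : exists x, splitting U x = g.
  by have [c cE] := splitting_onto g; exists (frame_comb c).
by exists h => // x; apply: inj; rewrite hK.
Qed.

(** The coefficients on monomials of the wrong parity are zero, again by [frame_coeff0]. *)
Lemma splitting_par_inv p x : ghomog p (ps_val (splitting U x)) -> ext_homog p x.
Proof.
have [c ->] := frame_comb_onto x => hc.
apply: big_ind => [||I _]; [exact: ext_homog0|exact: ext_homogD|].
have [oI|oI] := eqVneq (odd #|I|) p; last first.
  by rewrite (frame_coeff0 (hc I oI)) rmorph0 mul0r; exact: ext_homog0.
rewrite -[p]addFb; apply: ext_homogM; first exact: ext_homog_scal.
by rewrite -oI cardE; exact: ext_homog_word.
Qed.
End OnChart.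

Lemma dsum_locally_free : locally_free E.
Proof.
split; first by apply: omodule_dsum_sheaf => j; exact: twisting_sheafP.
move=> q; have [i Ui] := standard_open_cover q.
exists (standard_open C i), n, (frame (@subset_refl _ _)); split=> // W h s.
have [a [sa uniq]] := frameP h s.
(* The restricted frame is the frame built directly on [W], to which [frameP] applies. *)
have fE j : mres h (frame (@subset_refl _ _) j) = frame h j.
  apply: functional_extensionality_dep => k; rewrite /= /dsum_res /frame.
  case: eqP => _ /=; apply: val_inj; apply: regfunP => v //=.
have sumE (a' : 'I_n -> regfun OP W) :
    \sum_j a' j *: mres h (frame (@subset_refl _ _) j) = \sum_j a' j *: frame h j.
  by apply: eq_bigr => j _; rewrite fE.
exists a; split=> [|a']; first by rewrite sumE.
by rewrite sumE; exact: uniq.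
Qed.
End Splitting.

(** * The global isomorphism *)

Section Assembly.
Variables (C : numClosedFieldType) (m n : nat) (b : 'I_n -> int).
Local Notation P := (projective_space C m).
Local Notation OP := (projective_sheaf C m).
Local Notation OV := (punctured_sheaf C m).
Local Notation E := (omodule_dsum (fun j : 'I_n => twisting_sheaf C m (- b j))).
Local Notation F := (ssheaf (projective_superspace C m b)).
Local Notation G := (sheafify (ext_presheaf E)).

(** Parity is the vanishing of certain coefficients, which is checked pointwise on the cone. *)
Lemma superspace_par_local (U : opens P) p (t : F U) :
  (forall x, oset U x -> exists (V : opens P) (h : V `<=` U),
    oset V x /\ ppar p (pres h t)) -> ppar p t.
Proof.
move=> loc I oI; apply: regfunP => v.
have [W [h [Wv /(_ I oI)]]] := loc _ (set_mem (valP v) : oset U (proj (val v))).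
have Wv' : oset (cone W) (val v) by [].
rewrite ffunE => e; pose v' : cone W := exist _ (val v) (mem_set Wv').
have /= := congr1 (fun r : regfun OV (cone W) => r v') e.
by rewrite (_ : incl _ v' = v) //; exact: val_inj.
Qed.

Lemma split_projective_iso : exists phi : forall U, {rmorphism G U -> F U},
  (forall U, super_iso (phi U)) /\
  forall (U V : opens P) (h : V `<=` U) s, phi V (pres h s) = pres h (phi U s).
Proof.
pose theta (U : opens P) : {rmorphism ext_presheaf E U -> F U} := splitting b U.
have theta_res (U V : opens P) (h : V `<=` U) s :
  theta V (pres h s) = pres h (theta U s) by exact: splitting_res.
have theta_scal U c : theta U (pscal (ext_presheaf E) U c) = pscal F U c.
  exact: splitting_scal.
have theta_par (U : opens P) p (s : ext_presheaf E U) :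
  ppar p s -> ppar p (theta U s) by exact: splitting_par.
have theta_loc x : exists2 U : opens P, oset U x &
    forall W : opens P, W `<=` U -> bijective (theta W) /\
    forall p s, ppar p (theta W s) -> ppar p s.
  have [i Ui] := standard_open_cover x; exists (standard_open C i) => // W h.
  split; first exact: splitting_bijective h.
  by move=> p s; exact: (splitting_par_inv h).
have sh : is_sheaf (fun U V h => pres h : F U -> F V) by exact: superspace_sheaf.
exists (fun U => (@glued_map _ _ _ _ _ theta_res sh U : {rmorphism G U -> F U})).
split=> [U|U V h s]; last exact: glued_map_res.
by apply: glued_map_iso => //; exact: superspace_par_local.
Qed.

Lemma projective_superspace_split :
  @second_countable P ->
  isomorphic_supermanifolds (projective_superspace C m b) (split_superspace E).
Proof.
move=> sc; have [phi [phi_iso phi_res]] := split_projective_iso.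
(* The local model of a supermanifold asks for maps out of the structure sheaf, so the projective
   side needs the inverse of [phi]. *)
have [psi [psi_iso psi_res]] := super_iso_sym phi_iso phi_res.
have man := projective_manifold sc.
have lf := @dsum_locally_free C m n b.
split.
- split.
  + exact: superspace_sheaf.
  + exact: superspace_supercommutative.
  + exact: superspace_local_ring.
  exists (projective_sheaf C m); split=> //; exists E; split=> // x.
  exists (opensT _); split=> //; exact: super_iso_isomorphic_on psi_iso psi_res _.
- split.
  + exact: super_iso_sheaf phi_iso phi_res (@superspace_sheaf C m n b).
  + move=> U; apply: (super_iso_supercommutative phi_iso).
    exact: superspace_supercommutative.
  + move=> x; apply: (super_iso_local_ring phi_iso phi_res).
    exact: superspace_local_ring.
  exists (projective_sheaf C m); split=> //; exists E; split=> // x.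
  exists (opensT _); split=> //; exact: isomorphic_on_refl.
have idc : continuous (idfun : P -> P) by move=> x A.
exists idfun, idfun, idc; split=> //.
(* The preimage of V under the identity has the same points but carries another proof of openness,
   so the sections are moved along restrictions both ways. *)
have sub (V : opens P) : opreim idc V `<=` V by [].
have bus (V : opens P) : V `<=` opreim idc V by [].
exists (fun V => (pres (sub V) \o phi V : {rmorphism G V -> F (opreim idc V)})).
split=> [V|V W h k s].
  have [bij sc_ par] := phi_iso V; split.
  - apply: bij_comp bij; exists (pres (bus V)) => t.
      by rewrite (pres_comp _ _ (@subset_refl _ _)) pres_id.
    by rewrite (pres_comp _ _ (@subset_refl _ _)) pres_id.
  - move=> c; rewrite -[LHS]/(pres (sub V) (phi V _)) sc_; exact: pres_scal.
  - move=> p s; split=> [/par/(pres_par (sub V))//|].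
    move=> /(pres_par (bus V)).
    rewrite -[pres (bus V) _]/(pres (bus V) (pres (sub V) (phi V s))).
    by rewrite (pres_comp (sub V) (bus V) (@subset_refl _ _)) pres_id => /par.
rewrite -[LHS]/(pres (sub W) (phi W (pres h s))).
rewrite -[RHS]/(pres k (pres (sub V) (phi V s))).
rewrite phi_res (pres_comp _ _ (subset_trans (sub W) h)).
by rewrite (pres_comp (sub V) k (subset_trans (sub W) h)).
Qed.
End Assembly.

Theorem theorem3p3 (R : realType) (m n : nat) (b : 'I_n -> int) :
  isomorphic_supermanifolds
    (projective_superspace R[i] m b)
    (split_superspace (omodule_dsum (fun j : 'I_n =>
       twisting_sheaf R[i] m (- b j)))).
Proof.
apply: projective_superspace_split; apply: projective_second_countable.
- exact: rational_complex_dense.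
- exact: complex_archimedean.
Qed.
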